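(* Every cyclic $A_\infty$-algebra $(\mathcal H,\omega,\mathfrak m)$ over $\mathbb C$ is cyclic $A_\infty$-isomorphic to the direct sum of a minimal cyclic $A_\infty$-algebra and a linear contractible cyclic $A_\infty$-algebra.
   Context: Vector spaces are $\mathbb Z$-graded over $\mathbb C$. In exponents of $(-1)$, $o$ denotes the degree of a homogeneous element $o$. An $A_\infty$-algebra $(\mathcal H,\mathfrak m)$ is a graded vector space with degree $+1$ multilinear maps $m_k:\mathcal H^{\otimes k}\to\mathcal H$ $(k\ge1)$ such that for all $n\ge1$ and homogeneous $o_1,\dots,o_n$ $$\sum_{k+l=n+1}\sum_{j=0}^{k-1}(-1)^{o_1+\cdots+o_j}m_k(o_1,\dots,o_j,m_l(o_{j+1},\dots,o_{j+l}),o_{j+l+1},\dots,o_n)=0 .$$ The $m_k$ lift to a coderivation $\mathfrak m$ of the tensor coalgebra $C(\mathcal H)=\oplus_{n\ge0}\mathcal H^{\otimes n}$ with $\mathfrak m^2=0$. An $A_\infty$-morphism $\mathcal F=\{f_k\}_{k\ge1}:(\mathcal H,\mathfrak m)\to(\mathcal H',\mathfrak m')$ is a collection of degree $0$ maps $f_k:\mathcal H^{\otimes k}\to\mathcal H'$ whose induced coalgebra map $\mathcal F(o_1\cdots o_n)=\sum_{1\le k_1<\cdots<k_i=n} f_{k_1}(o_1,\dots,o_{k_1})\otimes\cdots\otimes f_{n-k_{i-1}}(o_{k_{i-1}+1},\dots,o_n)$ satisfies $\mathcal F\mathfrak m=\mathfrak m'\mathcal F$. It is an $A_\infty$-isomorphism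 if $f_1$ is an isomorphism. An odd constant symplectic structure on $\mathcal H$ is a nondegenerate bilinear map $\omega:\mathcal H\otimes\mathcal H\to\mathbb C$ of degree $-1$ (so $\omega(o,o')\ne0$ only if $\deg o+\deg o'=1$) with $\omega(o',o)=-\omega(o,o')$. A cyclic $A_\infty$-algebra $(\mathcal H,\omega,\mathfrak m)$ is an $A_\infty$-algebra with such an $\omega$ satisfying, for all $k\ge1$ and homogeneous elements, $$\omega(o_1,m_k(o_2,\dots,o_{k+1}))=(-1)^{o_2}\omega(o_2,m_k(o_3,\dots,o_{k+1},o_1)).$$ A cyclic $A_\infty$-morphism $(\mathcal H,\omega,\mathfrak m)\to(\mathcal H',\omega',\mathfrak m')$ is an $A_\infty$-morphism with $\omega'(f_1(o),f_1(o'))=\omega(o,o')$ for all $o,o'$ and, for every $n\ge3$, $\sum_{k+l=n,\,k,l\ge1}\omega'(f_k(o_1,\dots,o_k),f_l(o_{k+1},\dots,o_n))=0$ for all $o_1,\dots,o_n$. It is a cyclic $A_\infty$-isomorphism if moreover $f_1$ is an isomorphism. A (cyclic) $A_\infty$-algebra is minimal if $m_1=0$, and linear contractible if $m_k=0$ for $k\ge2$ and $m_1$ has zero cohomology. In the direct sum of cyclic $A_\infty$-algebras, both the operations $m_k$ and the symplectic structure are the direct sums (terms mixing the two summands vanish). *)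

(* Defs.v *)
From HB Require Import structures.
From mathcomp Require Import all_boot all_order all_algebra.
Set Implicit Arguments.
Unset Strict Implicit.
Unset Printing Implicit Defensive.
Import GRing.Theory.
Local Open Scope ring_scope.

(* Z-graded vector spaces, presented internally: a vector space which is the
   direct sum of the subspaces of homogeneous elements of each degree.
   The zero vector is homogeneous of every degree. *)
Record gradedSpace (K : fieldType) := GradedSpace {
  gs_space :> lmodType K;
  homog : int -> gs_space -> Prop;
  homog0 : forall d, homog d 0;
  homogP : forall d a x y, homog d x -> homog d y -> homog d (a *: x + y);
  homog_span : forall x, exists2 s : seq (int * gs_space),
    (forall t, t \in s -> homog t.1 t.2) & x = \sum_(t <- s) t.2;
  homog_direct : forall (ds : seq int) (y : int -> gs_space), uniq ds ->
    (forall d, homog d (y d)) -> \sum_(d <- ds) y d = 0 ->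
    forall d, d \in ds -> y d = 0
}.

(* A collection of k-ary maps V^k -> W, k >= 1, is encoded as one function on
   sequences: its k-ary member is the restriction to sequences of size k.
   Nothing is ever required of, or read from, the value at [::]. *)
Definition multilinear (K : fieldType) (V W : lmodType K) (f : seq V -> W) :=
  forall (s1 s2 : seq V) (a : K) (x y : V),
    f (s1 ++ (a *: x + y) :: s2) = a *: f (s1 ++ x :: s2) + f (s1 ++ y :: s2).

(* A word o_1 ... o_n of vectors, each carried with its degree. *)
Definition word (K : fieldType) (V : lmodType K) : Type := seq (int * V)%type.

Section Words.
Variables (K : fieldType) (V : lmodType K).
Implicit Type w : word V.

Definition wdeg w : int := \sum_(t <- w) t.1.

Definition wvec w : seq V := unzip2 w.

Definition wsign w : K := (-1) ^ wdeg w.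

End Words.

Definition homog_word (K : fieldType) (V : gradedSpace K) (w : word V) :=
  forall t, t \in w -> homog t.1 t.2.

Definition has_degree (K : fieldType) (V W : gradedSpace K) (e : int)
    (f : seq V -> W) :=
  forall w : word V, w != [::] -> homog_word w ->
    homog (wdeg w + e) (f (wvec w)).

Definition ainf_relations (K : fieldType) (V : gradedSpace K)
    (m : seq V -> V) :=
  forall w : word V, (1 <= size w)%N -> homog_word w ->
    \sum_(1 <= k < (size w).+1)
     \sum_(1 <= l < (size w).+1 | (k + l == (size w).+1)%N)
      \sum_(0 <= j < k)
        wsign (take j w) *:
          m (wvec (take j w) ++
             m (wvec (take l (drop j w))) :: wvec (drop (j + l) w)) = 0.

Record ainfAlgebra (K : fieldType) := AinfAlgebra {
  ainf_space :> gradedSpace K;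
  ainf_op : seq ainf_space -> ainf_space;
  ainf_multilinear : multilinear ainf_op;
  ainf_degree : has_degree 1 ainf_op;
  ainf_rel : ainf_relations ainf_op
}.

(* Elements of the tensor coalgebra C(V) are written as formal linear
   combinations of words; by the universal property of tensor powers, two of
   them are equal in C(V) iff every family of multilinear maps takes the same
   value on both. *)
Definition tensor (K : fieldType) (V : lmodType K) : Type :=
  seq (K * word V)%type.

Definition tensor_eq (K : fieldType) (V : lmodType K) (u v : tensor V) :=
  forall (W : lmodType K) (phi : seq V -> W), multilinear phi ->
    \sum_(t <- u) t.1 *: phi (wvec t.2) = \sum_(t <- v) t.1 *: phi (wvec t.2).

Definition tensor_ext (K : fieldType) (V V' : lmodType K)
    (g : word V -> tensor V') (u : tensor V) : tensor V' :=
  flatten [seq [seq (t.1 * t'.1, t'.2) | t' <- g t.2] | t <- u].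

Definition coderivation (K : fieldType) (V : lmodType K) (m : seq V -> V)
    (w : word V) : tensor V :=
  [seq (wsign (take j w),
        take j w ++ (wdeg (take l (drop j w)) + 1,
                     m (wvec (take l (drop j w)))) :: drop (j + l) w)
     | l <- iota 1 (size w), j <- iota 0 (size w - l).+1].

(* All the ways of cutting a sequence into consecutive nonempty blocks. *)
Fixpoint blocks (T : Type) (s : seq T) : seq (seq (seq T)) :=
  if s is x :: s' then
    flatten [seq ([:: x] :: p) ::
                 (if p is b :: q then [:: (x :: b) :: q] else [::])
               | p <- blocks s']
  else [:: [::]].

Definition coalgebra_map (K : fieldType) (V V' : lmodType K)
    (f : seq V -> V') (w : word V) : tensor V' :=
  [seq (1, [seq (wdeg b, f (wvec b)) | b <- p]) | p <- blocks w].

Definition ainf_morphism (K : fieldType) (A B : ainfAlgebra K)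
    (f : seq A -> B) :=
  [/\ multilinear f, has_degree 0 f &
      forall w : word A, homog_word w ->
        tensor_eq
          (tensor_ext (coalgebra_map f) (coderivation (@ainf_op K A) w))
          (tensor_ext (coderivation (@ainf_op K B)) (coalgebra_map f w))].

(* Nondegenerate means that the induced map to the graded dual is an
   isomorphism, i.e. that V_d -> (V_(1-d))^* is bijective for every d; linear
   forms on V_(1-d) are given as restrictions of linear forms on V.  Mere
   injectivity is strictly weaker when some V_d is infinite-dimensional. *)
Definition nondegenerate (K : fieldType) (V : gradedSpace K)
    (omega : V -> V -> K) :=
  (forall x, (forall y, omega x y = 0) -> x = 0) /\
  (forall (d : int) (lam : {scalar V}), exists2 x, homog d x &
     forall y, homog (1 - d) y -> omega x y = lam y).

Record odd_symplectic (K : fieldType) (V : gradedSpace K)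
    (omega : V -> V -> K) : Prop := OddSymplectic {
  symp_linl : forall y a x x',
    omega (a *: x + x') y = a * omega x y + omega x' y;
  symp_linr : forall x a y y',
    omega x (a *: y + y') = a * omega x y + omega x y';
  symp_degree : forall d e x y, homog d x -> homog e y ->
    omega x y != 0 -> d + e = 1;
  symp_skew : forall x y, omega y x = - omega x y;
  symp_nondeg : nondegenerate omega
}.

Definition cyclic_relations (K : fieldType) (V : gradedSpace K)
    (omega : V -> V -> K) (m : seq V -> V) :=
  forall (d1 d2 : int) (o1 o2 : V) (w : word V),
    homog d1 o1 -> homog d2 o2 -> homog_word w ->
    omega o1 (m (o2 :: wvec w)) =
      (-1) ^ d2 * omega o2 (m (rcons (wvec w) o1)).

Record cyclicAinf (K : fieldType) := CyclicAinf {
  cyc_ainf :> ainfAlgebra K;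
  cyc_form : cyc_ainf -> cyc_ainf -> K;
  cyc_symp : odd_symplectic cyc_form;
  cyc_rel : cyclic_relations cyc_form (@ainf_op K cyc_ainf)
}.

Definition cyclic_ainf_morphism (K : fieldType) (A B : cyclicAinf K)
    (f : seq A -> B) :=
  [/\ ainf_morphism f,
      forall x y : A, cyc_form (f [:: x]) (f [:: y]) = cyc_form x y &
      forall s : seq A, (3 <= size s)%N ->
        \sum_(1 <= k < size s) cyc_form (f (take k s)) (f (drop k s)) = 0].

Definition cyclic_ainf_isomorphism (K : fieldType) (A B : cyclicAinf K)
    (f : seq A -> B) :=
  cyclic_ainf_morphism f /\ bijective (fun x : A => f [:: x]).

Definition minimal (K : fieldType) (A : ainfAlgebra K) :=
  forall x : A, ainf_op [:: x] = 0.

Definition linear_contractible (K : fieldType) (A : ainfAlgebra K) :=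
  (forall s : seq A, (2 <= size s)%N -> ainf_op s = 0) /\
  (forall x : A, ainf_op [:: x] = 0 -> exists y : A, x = ainf_op [:: y]).

Section DirectSum.
Variable K : fieldType.

Section Graded.
Variables V1 V2 : gradedSpace K.

Let V : lmodType K := (V1 * V2)%type.

Definition dsum_homog (d : int) (x : V) := homog d x.1 /\ homog d x.2.

Fact dsum_homog0 d : dsum_homog d 0.
Proof. by split; apply: homog0. Qed.

Fact dsum_homogP d a (x y : V) :
  dsum_homog d x -> dsum_homog d y -> dsum_homog d (a *: x + y).
Proof. by move=> [x1 x2] [y1 y2]; split; apply: homogP. Qed.

Lemma sum_pair (I : Type) (r : seq I) (F : I -> V) :
  \sum_(i <- r) F i = (\sum_(i <- r) (F i).1, \sum_(i <- r) (F i).2).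
Proof.
by elim: r => [|i r IH]; rewrite ?big_nil // !big_cons IH; case: (F i).
Qed.

Fact dsum_homog_span (x : V) : exists2 s : seq (int * V),
  (forall t, t \in s -> dsum_homog t.1 t.2) & x = \sum_(t <- s) t.2.
Proof.
have [s1 h1 e1] := homog_span x.1; have [s2 h2 e2] := homog_span x.2.
exists ([seq (t.1, (t.2, 0) : V) | t <- s1] ++
        [seq (t.1, (0, t.2) : V) | t <- s2]).
  move=> t; rewrite mem_cat => /orP[] /mapP[u us ->]; split => /=.
  - exact: h1.
  - exact: homog0.
  - exact: homog0.
  - exact: h2.
rewrite big_cat !big_map !sum_pair /= !big1_eq.
by rewrite -e1 -e2; case: x {e1 e2} => a b; congr (_, _);
   rewrite ?addr0 ?add0r.
Qed.

Fact dsum_homog_direct (ds : seq int) (y : int -> V) : uniq ds ->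
  (forall d, dsum_homog d (y d)) -> \sum_(d <- ds) y d = 0 ->
  forall d, d \in ds -> y d = 0.
Proof.
move=> uds hy; rewrite sum_pair => -[e1 e2] d dds.
have := homog_direct uds (fun d => (hy d).1) e1 dds.
have := homog_direct uds (fun d => (hy d).2) e2 dds.
by case: (y d) => a b /= -> ->.
Qed.

Definition dsum_space : gradedSpace K :=
  GradedSpace dsum_homog0 dsum_homogP dsum_homog_span dsum_homog_direct.

Lemma dsum_sum1 (I : Type) (r : seq I) (P : pred I) (F : I -> dsum_space) :
  (\sum_(i <- r | P i) F i).1 = \sum_(i <- r | P i) (F i).1.
Proof. exact: (big_morph (fun x : dsum_space => x.1)). Qed.

Lemma dsum_sum2 (I : Type) (r : seq I) (P : pred I) (F : I -> dsum_space) :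
  (\sum_(i <- r | P i) F i).2 = \sum_(i <- r | P i) (F i).2.
Proof. exact: (big_morph (fun x : dsum_space => x.2)). Qed.

End Graded.

Section Projections.
Variables V1 V2 : gradedSpace K.

Definition word1 (w : word (dsum_space V1 V2)) : word V1 :=
  [seq (t.1, t.2.1) | t <- w].

Definition word2 (w : word (dsum_space V1 V2)) : word V2 :=
  [seq (t.1, t.2.2) | t <- w].

Lemma wdeg1 w : wdeg (word1 w) = wdeg w.
Proof. by rewrite /wdeg big_map. Qed.

Lemma wdeg2 w : wdeg (word2 w) = wdeg w.
Proof. by rewrite /wdeg big_map. Qed.

Lemma wvec1 w : [seq x.1 | x <- wvec w] = wvec (word1 w).
Proof. by rewrite /wvec /unzip2 -!map_comp. Qed.

Lemma wvec2 w : [seq x.2 | x <- wvec w] = wvec (word2 w).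
Proof. by rewrite /wvec /unzip2 -!map_comp. Qed.

Lemma homog_word1 w : homog_word w -> homog_word (word1 w).
Proof. by move=> h t /mapP[u /h[h1 h2] ->]. Qed.

Lemma homog_word2 w : homog_word w -> homog_word (word2 w).
Proof. by move=> h t /mapP[u /h[h1 h2] ->]. Qed.

End Projections.

Section Ainf.
Variables A1 A2 : ainfAlgebra K.

Let V := dsum_space A1 A2.

Definition dsum_op (s : seq V) : V :=
  (ainf_op [seq x.1 | x <- s], ainf_op [seq x.2 | x <- s]).

Fact dsum_multilinear : multilinear dsum_op.
Proof.
move=> s1 s2 a x y; rewrite /dsum_op !map_cat /=.
by rewrite !ainf_multilinear.
Qed.

Fact dsum_degree : has_degree 1 dsum_op.
Proof.
move=> w w0 hw; split; rewrite /dsum_op /=.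
  rewrite wvec1 -wdeg1; apply: ainf_degree (homog_word1 hw).
  by case: (w) w0.
rewrite wvec2 -wdeg2; apply: ainf_degree (homog_word2 hw).
by case: (w) w0.
Qed.

Fact dsum_rel : ainf_relations dsum_op.
Proof.
move=> w w0 hw.
have := @ainf_rel K A1 (word1 w); have := @ainf_rel K A2 (word2 w).
rewrite !size_map => /(_ w0 (homog_word2 hw)) e2 /(_ w0 (homog_word1 hw)) e1.
rewrite [LHS]surjective_pairing dsum_sum1 dsum_sum2.
congr (_, _); [rewrite -[RHS]e1|rewrite -[RHS]e2];
  apply: eq_bigr => k _; rewrite ?dsum_sum1 ?dsum_sum2;
  apply: eq_bigr => l _; rewrite ?dsum_sum1 ?dsum_sum2;
  apply: eq_bigr => j _; rewrite /= !map_cat /=.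
  by rewrite /word1 -!map_take -!map_drop -!map_take -!/(word1 _)
             !wvec1 /wsign wdeg1.
by rewrite /word2 -!map_take -!map_drop -!map_take -!/(word2 _)
           !wvec2 /wsign wdeg2.
Qed.

Definition dsum_ainf : ainfAlgebra K :=
  AinfAlgebra dsum_multilinear dsum_degree dsum_rel.

End Ainf.

Section Cyclic.
Variables A1 A2 : cyclicAinf K.

Let A := dsum_ainf A1 A2.

Definition dsum_form (x y : A) : K :=
  cyc_form x.1 y.1 + cyc_form x.2 y.2.

Lemma cyc_form0r (B : cyclicAinf K) (x : B) : cyc_form x 0 = 0.
Proof.
apply: (@addIr _ (cyc_form x 0)).
by rewrite add0r -{1}[cyc_form x 0]mul1r -(symp_linr (cyc_symp B)) scaler0 addr0.
Qed.

Lemma cyc_form0l (B : cyclicAinf K) (x : B) : cyc_form 0 x = 0.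
Proof. by rewrite (symp_skew (cyc_symp B)) cyc_form0r oppr0. Qed.

Fact dsum_nondegenerate : nondegenerate dsum_form.
Proof.
split=> [[x1 x2] h|d lam].
  congr (_, _).
    apply: (symp_nondeg (cyc_symp A1)).1 => y.
    by have := h (y, 0); rewrite /dsum_form /= cyc_form0r addr0.
  apply: (symp_nondeg (cyc_symp A2)).1 => y.
  by have := h (0, y); rewrite /dsum_form /= cyc_form0r add0r.
pose l1 (y : A1) : K := lam (y, 0); pose l2 (y : A2) : K := lam (0, y).
have l1P : scalar l1.
  move=> a x y; rewrite /l1 -linearP; congr (lam _).
  by congr (_, _); rewrite /= scaler0 addr0.
have l2P : scalar l2.
  move=> a x y; rewrite /l2 -linearP; congr (lam _).
  by congr (_, _); rewrite /= scaler0 addr0.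
pose L1 := GRing.isLinear.Build K A1 K *%R l1 l1P.
pose L2 := GRing.isLinear.Build K A2 K *%R l2 l2P.
pose L1' : {scalar A1} := HB.pack l1 L1.
pose L2' : {scalar A2} := HB.pack l2 L2.
have [x1 hx1 e1] := (symp_nondeg (cyc_symp A1)).2 d L1'.
have [x2 hx2 e2] := (symp_nondeg (cyc_symp A2)).2 d L2'.
exists (x1, x2) => // -[y1 y2] [/= /e1 hy1 /e2 hy2].
rewrite /dsum_form /= hy1 hy2 /= /l1 /l2 -raddfD; congr (lam _).
by congr (_, _); rewrite ?addr0 ?add0r.
Qed.

Fact dsum_symplectic : odd_symplectic dsum_form.
Proof.
split; last exact: dsum_nondegenerate.
- move=> y a x x'; rewrite /dsum_form /=.
  by rewrite !(symp_linl (cyc_symp _)) mulrDr addrACA.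
- move=> x a y y'; rewrite /dsum_form /=.
  by rewrite !(symp_linr (cyc_symp _)) mulrDr addrACA.
- move=> d e x y [hx1 hx2] [hy1 hy2]; rewrite /dsum_form.
  case: (eqVneq (cyc_form x.1 y.1) 0) => [->|h _].
    by rewrite add0r; apply: (symp_degree (cyc_symp A2)).
  exact: (symp_degree (cyc_symp A1)) h.
- move=> x y; rewrite /dsum_form opprD.
  by rewrite !(symp_skew (cyc_symp _) y.1) !(symp_skew (cyc_symp _) y.2) !opprK.
Qed.

Fact dsum_cyclic : cyclic_relations dsum_form (@ainf_op K A).
Proof.
move=> d1 d2 o1 o2 w [h11 h12] [h21 h22] hw.
rewrite /dsum_form /= !map_rcons wvec1 wvec2 mulrDr.
by congr (_ + _); [apply: cyc_rel (homog_word1 hw) |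
                   apply: cyc_rel (homog_word2 hw)]; eassumption.
Qed.

Definition dsum : cyclicAinf K := CyclicAinf dsum_symplectic dsum_cyclic.

End Cyclic.
End DirectSum.

(* Main.v *)
Require Import Defs.
From HB Require Import structures.
From mathcomp Require Import all_boot all_order all_algebra.
From mathcomp Require Import boolp classical_sets.
From mathcomp Require Import reals complex.
From mathcomp Require Import ring zify.
Set Implicit Arguments.
Unset Strict Implicit.
Unset Printing Implicit Defensive.
Import GRing.Theory.
Local Open Scope ring_scope.

(** Write m for the operations of the algebra, d for the unary one, w for the
form.  The parity automorphism [parity], multiplication by (-1)^n in degree
n, absorbs all the signs: if [minsert parity g m] denotes the composite of g
with the coderivation defined by m, and [mcomp g f] the composite of g with
the coalgebra map defined by f, then the A-infinity relations read
[minsert parity m m = 0] and a morphism satisfies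
[mcomp m' f = minsert parity f m].  Viewing the form as a family W whose only
nonzero member is binary ([form_seq]), cyclicity of m reads
[minsert parity W m = 0] and cyclicity of a morphism f reads
[mcomp W f = W].  So a single fact, that a morphism intertwines the
coderivations on every multilinear family ([minsert_mcomp]), transports both
the relations and the cyclicity along an invertible f ([transport]).

The proof brings m to a normal form, one arity after the other.

Linear algebra ([hodge_contraction]) gives a homotopy h for d which is
self-adjoint for w and satisfies hh = 0, dhd = d, hdh = h; then dh + hd is a
self-adjoint projection onto an acyclic complement of the harmonic part
H = ker (dh + hd).

Assume that the operations of arity between 2 and n - 1 only see H, that is,
take their values in H and factor through the projection onto H.  Let Y be
the operation of arity n.  A cyclic X of arity n and degree 0 gives rise to a
form preserving automorphism, its Cayley transform ([cayley]), and transport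
along it replaces Y by Y - [d, X].  Let h act on the cyclic tensor w(_, Y)
slot by slot; this gives a cyclic X whose commutator with d is the weight
operator N applied to Y ([homotopy_formula]), where N counts the slots, the
output included, that are filled by acyclic elements.  As the characteristic
is zero, the factors 1 - N/j for j = 1, ..., n + 1 can be applied in turn;
only the part of weight zero survives, which means that the new operation
only sees H ([depleted_harmonic]).

The automorphism used in arity n is the identity in lower arities, so the
infinite composite makes sense ([limit_normal_form]).  In the limit all
operations of arity at least 2 only see H, and d vanishes on H: the two
projections commute with all operations, and the algebra splits as the direct
sum of H, which is minimal, and of the acyclic part, on which d is the only
operation ([split_isomorphism]). *)

(** * Sums over the cuts of a sequence *)

Section CutSums.
Variables (T : Type) (W : zmodType).
Implicit Types (G : seq T -> seq T -> W) (s : seq T).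

(** [csum G s] is the sum of [G a b] over all cuts [s = a ++ b], and [ncsum]
    restricts it to nonempty [a].  The structural recursion, unlike a sum over
    indices, lets the proofs below proceed letter by letter. *)
Fixpoint csum G s : W :=
  G [::] s + (if s is x :: s' then csum (fun a => G (x :: a)) s' else 0).

Definition ncsum G s : W :=
  if s is x :: s' then csum (fun a => G (x :: a)) s' else 0.

Lemma csumE G s : csum G s = G [::] s + ncsum G s.
Proof. by case: s. Qed.

Lemma eq_csum G G' s :
  (forall a b, a ++ b = s -> G a b = G' a b) -> csum G s = csum G' s.
Proof.
elim: s G G' => [|x s IH] G G' h /=; first by rewrite h.
by rewrite h //; congr (_ + _); apply: IH => a b e; apply: h; rewrite /= e.
Qed.

Lemma eq_ncsum G G' s :
  (forall x a b, x :: a ++ b = s -> G (x :: a) b = G' (x :: a) b) ->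
  ncsum G s = ncsum G' s.
Proof.
by case: s => //= x s h; apply: eq_csum => a b e; apply: h; rewrite e.
Qed.

Lemma csum0 s : csum (fun _ _ => 0) s = 0.
Proof. by elim: s => [|x s IH] /=; rewrite ?IH addr0. Qed.

Lemma ncsum0 s : ncsum (fun _ _ => 0) s = 0.
Proof. by case: s => //= x s; rewrite csum0. Qed.

Lemma csumD G G' s :
  csum (fun a b => G a b + G' a b) s = csum G s + csum G' s.
Proof.
by elim: s G G' => [|x s IH] G G' /=; rewrite ?addr0 // IH addrACA.
Qed.

Lemma ncsumD G G' s :
  ncsum (fun a b => G a b + G' a b) s = ncsum G s + ncsum G' s.
Proof. by case: s => [|x s] /=; rewrite ?addr0 // csumD. Qed.

(** Coassociativity of deconcatenation. *)
Lemma csum_assoc (F : seq T -> seq T -> seq T -> W) s :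
  csum (fun a b => csum (F a) b) s =
  csum (fun ab d => csum (fun a c => F a c d) ab) s.
Proof.
elim: s F => [|x s IH] F //=; rewrite IH csumD !addr0.
by rewrite addrA.
Qed.

Lemma ncsum_assoc (F : seq T -> seq T -> seq T -> W) s :
  ncsum (fun a b => csum (F a) b) s =
  ncsum (fun ab d => ncsum (fun a c => F a c d) ab) s.
Proof. by case: s => //= x s; rewrite csum_assoc. Qed.

Lemma csum_rcons G s y :
  csum G (rcons s y) = csum (fun a b => G a (rcons b y)) s + G (rcons s y) [::].
Proof.
elim: s G => [|x s IH] G /=; first by rewrite !addr0.
by rewrite IH addrA.
Qed.

Lemma csum_last G s :
  (forall a y b, a ++ y :: b = s -> G a (y :: b) = 0) -> csum G s = G s [::].
Proof.
elim: s G => [|x s IH] G h /=; first by rewrite addr0.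
by rewrite (h [::]) // add0r IH // => a y b e; apply: h; rewrite /= e.
Qed.

Lemma csum_index G s :
  csum G s = \sum_(0 <= i < (size s).+1) G (take i s) (drop i s).
Proof.
elim: s G => [|x s IH] G /=; first by rewrite big_nat1 addr0.
by rewrite big_nat_recl //= IH.
Qed.

Lemma ncsum_index G s :
  ncsum G s = \sum_(1 <= i < (size s).+1) G (take i s) (drop i s).
Proof.
case: s => [|x s] /=; first by rewrite big_geq.
by rewrite csum_index big_add1 /=; apply: eq_bigr.
Qed.

End CutSums.

Lemma csum_morph (T : Type) (W W' : zmodType) (phi : W -> W')
    (G : seq T -> seq T -> W) s : {morph phi : x y / x + y} ->
  phi (csum G s) = csum (fun a b => phi (G a b)) s.
Proof.
move=> pD; have p0 : phi 0 = 0.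
  by apply: (@addIr _ (phi 0)); rewrite -pD !add0r.
by elim: s G => [|x s IH] G /=; rewrite pD ?p0 // IH.
Qed.

Lemma csum_map (T T' : Type) (W : zmodType) (u : T -> T')
    (G : seq T' -> seq T' -> W) s :
  csum G (map u s) = csum (fun a b => G (map u a) (map u b)) s.
Proof. by elim: s G => [|x s IH] G //=; rewrite IH. Qed.

Lemma ncsum_map (T T' : Type) (W : zmodType) (u : T -> T')
    (G : seq T' -> seq T' -> W) s :
  ncsum G (map u s) = ncsum (fun a b => G (map u a) (map u b)) s.
Proof. by case: s => [|x s] //=; rewrite csum_map. Qed.

(** * Multilinear families *)

Section Multilinear.
Variables (K : fieldType) (V W : lmodType K).
Implicit Types (f g : seq V -> W) (s : seq V).

Lemma multilinear_cons f v :
  multilinear f -> multilinear (fun t => f (v :: t)).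
Proof. by move=> hf s1; apply: (hf (v :: s1)). Qed.

Lemma multilinear_rcons f v :
  multilinear f -> multilinear (fun t => f (rcons t v)).
Proof. by move=> hf s1 s2 a x y; rewrite !rcons_cat /= hf. Qed.

Lemma multilinear_morph f s1 s2 : multilinear f ->
  {morph (fun x => f (s1 ++ x :: s2)) : x y / x + y}.
Proof. by move=> hf x y; rewrite -{1}[x]scale1r hf scale1r. Qed.

Lemma multilinear0 f s1 s2 : multilinear f -> f (s1 ++ 0 :: s2) = 0.
Proof.
move=> hf; apply: (@addIr _ (f (s1 ++ 0 :: s2))).
by rewrite -(multilinear_morph s1 s2 hf) !add0r.
Qed.

Lemma multilinearZ f s1 s2 a x : multilinear f ->
  f (s1 ++ a *: x :: s2) = a *: f (s1 ++ x :: s2).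
Proof.
by move=> hf; rewrite -[a *: x]addr0 hf multilinear0 // addr0.
Qed.

Lemma multilinearN f s1 s2 x : multilinear f ->
  f (s1 ++ - x :: s2) = - f (s1 ++ x :: s2).
Proof. by move=> hf; rewrite -scaleN1r multilinearZ // scaleN1r. Qed.

Lemma multilinear_sum f s1 s2 I (r : seq I) (F : I -> V) : multilinear f ->
  f (s1 ++ (\sum_(i <- r) F i) :: s2) = \sum_(i <- r) f (s1 ++ F i :: s2).
Proof.
move=> hf; elim: r => [|i r IH]; rewrite ?big_nil ?multilinear0 //.
by rewrite !big_cons (multilinear_morph s1 s2 hf) IH.
Qed.

Lemma multilinear_comb f g a : multilinear f -> multilinear g ->
  multilinear (fun s => a *: f s + g s).
Proof.
move=> hf hg s1 s2 b x y; rewrite hf hg !scalerDr !scalerA mulrC.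
by rewrite addrACA.
Qed.

Lemma multilinear_linear (U : lmodType K) (l : {linear W -> U}) f :
  multilinear f -> multilinear (fun s => l (f s)).
Proof. by move=> hf s1 s2 a x y; rewrite hf linearP. Qed.

Lemma multilinear_map (U : lmodType K) (l : {linear U -> V}) f :
  multilinear f -> multilinear (fun t => f (map l t)).
Proof. by move=> hf s1 s2 a x y; rewrite !map_cat /= linearP hf. Qed.

(** Used with homogeneous elements, for which signs can be computed, and with
    vectors that are either harmonic or acyclic, on which weights can. *)
Lemma multilinear_ext (S : V -> Prop) f g n :
    (forall x, exists2 l : seq V, (forall y, y \in l -> S y) &
                                  x = \sum_(y <- l) y) ->
    multilinear f -> multilinear g ->
    (forall s, size s = n -> (forall y, y \in s -> S y) -> f s = g s) ->
  forall s, size s = n -> f s = g s.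
Proof.
move=> span hf hg h s.
suff gen s1 s2 : (forall y, y \in s1 -> S y) -> size (s1 ++ s2) = n ->
    f (s1 ++ s2) = g (s1 ++ s2) by apply: (gen [::]).
elim: s2 s1 => [|x s2 IH] s1 h1 sz; first by rewrite cats0 in sz *; apply: h.
have [l hl ->] := span x.
rewrite !multilinear_sum //; apply: eq_big_seq => y /hl Sy.
rewrite -!cat_rcons; apply: IH => [z|].
  by rewrite mem_rcons inE => /orP[/eqP->|/h1].
by rewrite cat_rcons -sz !size_cat.
Qed.

End Multilinear.

(** * Insertions and composites *)

Section Insertion.
Variables (K : fieldType) (V W : lmodType K).
Implicit Types (e : V -> V) (g : seq V -> W) (m : seq V -> V) (s : seq V).

(** The sum over [s = a ++ b ++ c], with [b] nonempty, of
    [g (map e a ++ m b :: c)]: the composite of g with the coderivation defined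
    by m.  Moving m past the letters of a twists them by e, which is the parity
    for m of odd degree and the identity for m of even degree. *)
Fixpoint minsert e g m s : W :=
  if s is x :: s' then
    csum (fun b c => g (m (x :: b) :: c)) s' +
    minsert e (fun t => g (e x :: t)) m s'
  else 0.

Lemma minsertE e g m s :
  minsert e g m s =
  csum (fun a t => ncsum (fun b c => g (map e a ++ m b :: c)) t) s.
Proof. by elim: s g => [|x s IH] g /=; rewrite ?addr0 // IH. Qed.

Lemma minsert_cons e g m x s :
  minsert e g m (x :: s) =
  ncsum (fun b c => g (m b :: c)) (x :: s) +
  minsert e (fun t => g (e x :: t)) m s.
Proof. by []. Qed.

Lemma eq_minsert e g g' m m' s :
    (forall x a b c, a ++ x :: b ++ c = s ->
       g (map e a ++ m (x :: b) :: c) = g' (map e a ++ m' (x :: b) :: c)) ->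
  minsert e g m s = minsert e g' m' s.
Proof.
move=> h; rewrite !minsertE; apply: eq_csum => a t e1.
by apply: eq_ncsum => x b c e2; apply: h; rewrite e2 e1.
Qed.

Lemma minsertDl e g g' m s :
  minsert e (fun t => g t + g' t) m s = minsert e g m s + minsert e g' m s.
Proof.
elim: s g g' => [|x s IH] g g' /=; first by rewrite addr0.
by rewrite IH csumD addrACA.
Qed.

Lemma minsert0l e m s : minsert e (fun=> 0) m s = 0.
Proof. by elim: s => [|x s IH] //=; rewrite IH csum0 addr0. Qed.

Lemma minsertDr e g m m' s : multilinear g ->
  minsert e g (fun t => m t + m' t) s = minsert e g m s + minsert e g m' s.
Proof.
elim: s g => [|x s IH] g hg /=; first by rewrite addr0.
rewrite IH; last exact: multilinear_cons.
rewrite addrACA -csumD; congr (_ + _); apply: eq_csum => b c _.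
exact: (multilinear_morph [::] c hg).
Qed.

Lemma minsert0r e g s : multilinear g -> minsert e g (fun=> 0) s = 0.
Proof.
move=> hg; have h := @minsertDr e g (fun=> 0) (fun=> 0) s hg.
apply: (@addIr _ (minsert e g (fun=> 0) s)); rewrite -h [RHS]add0r.
by apply: eq_minsert => *; rewrite addr0.
Qed.

(** Leibniz rule: a coderivation acts on either factor of a cut, with the twist
    on the left factor when it acts on the right one. *)
Lemma minsert_csum e (G : seq V -> seq V -> W) m s :
  minsert e (fun t => csum G t) m s =
  csum (fun a b => minsert e (fun a' => G a' b) m a +
                   minsert e (fun b' => G (map e a) b') m b) s.
Proof.
elim: s G => [|x s IH] G /=; first by rewrite !addr0.
rewrite minsertDl IH !csumD add0r -!addrA; congr (_ + _).
rewrite csum_assoc addrCA; congr (_ + _).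
Qed.

Lemma minsert_ncsum e (G : seq V -> seq V -> W) m s :
  minsert e (fun t => ncsum G t) m s =
  ncsum (fun a b => minsert e (fun a' => G a' b) m a +
                    minsert e (fun b' => G (map e a) b') m b) s.
Proof.
pose G' a b := if nilp a then 0 else G a b.
have E t : csum G' t = ncsum G t.
  by rewrite csumE /G' /= add0r; apply: eq_ncsum.
transitivity (minsert e (fun t => csum G' t) m s).
  by apply: eq_minsert => *; rewrite E.
rewrite minsert_csum csumE /= add0r minsert0l add0r.
apply: eq_ncsum => x a b _; congr (_ + _); apply: eq_minsert => y c d q _ //.
Qed.

End Insertion.

Section InsertionLinear.
Variables (K : fieldType) (V W : lmodType K).

Lemma minsert_morph (W' : lmodType K) (phi : W -> W') e (g : seq V -> W) m s :
  {morph phi : x y / x + y} ->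
  phi (minsert e g m s) = minsert e (fun t => phi (g t)) m s.
Proof.
move=> pD; elim: s g => [|x s IH] g /=.
  by apply: (@addIr _ (phi 0)); rewrite -pD !add0r.
by rewrite pD IH (csum_morph _ _ pD).
Qed.

Lemma minsertZl e a (g : seq V -> W) m s :
  minsert e (fun t => a *: g t) m s = a *: minsert e g m s.
Proof.
rewrite -(@minsert_morph _ (fun x => a *: x)) //.
exact: scalerDr.
Qed.

Lemma csum_multilinear (G : seq V -> seq V -> W) :
    (forall b, multilinear (fun a => G a b)) ->
    (forall a, multilinear (G a)) ->
  multilinear (fun s => csum G s).
Proof.
move=> h1 h2 s1; elim: s1 G h1 h2 => [|z s1 IH] G h1 h2 s2 a x y /=.
  rewrite (h2 [::] [::]) scalerDr addrACA; congr (_ + _).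
  rewrite (csum_morph _ _ (scalerDr a)) -csumD; apply: eq_csum => p q _.
  exact: (h1 q [::]).
rewrite (h2 [::] (z :: s1)) IH ?scalerDr 1?addrACA // => b.
by apply: (@multilinear_cons _ _ _ (G^~ b)); apply: h1.
Qed.

Lemma minsert_multilinear (e : {linear V -> V}) (g : seq V -> W) m :
  multilinear g -> multilinear m -> multilinear (minsert e g m).
Proof.
move=> hg hm s1; elim: s1 g hg => [|z s1 IH] g hg s2 a x y /=.
  rewrite scalerDr addrACA; congr (_ + _).
    rewrite (csum_morph _ _ (scalerDr a)) -csumD; apply: eq_csum => p q _.
    by rewrite (hm [::]) (hg [::]).
  rewrite -minsertZl -minsertDl; apply: eq_minsert => u p q r _.
  by rewrite linearP (hg [::]).
rewrite IH ?scalerDr 1?addrACA; last exact: multilinear_cons.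
congr (_ + _); apply: csum_multilinear => [b|b].
  by move=> t1 t2 c u v; rewrite (hm (z :: t1)) (hg [::]).
exact: multilinear_cons.
Qed.

End InsertionLinear.

Section Composition.
Variables (K : fieldType) (V V' W : lmodType K).
Implicit Types (g : seq V' -> W) (f : seq V -> V') (s : seq V).

(** The composite of g with the coalgebra map defined by f. *)
Definition mcomp g f s : W := \sum_(P <- blocks s) g (map f P).

(** Splitting off the first block turns composites into iterated sums over
    cuts, where induction on the length applies. *)
Lemma big_blocks_cons (T : Type) (G : seq (seq T) -> W) x (s : seq T) :
  \sum_(P <- blocks (x :: s)) G P =
  csum (fun a b => \sum_(Q <- blocks b) G ((x :: a) :: Q)) s.
Proof.
elim: s x G => [|y s IH] x G; first by rewrite /= !big_seq1 addr0.
set t := y :: s; rewrite csumE /=.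
set G' := fun P => (G ([:: x] :: P) +
     if P is b :: Q then G ((x :: b) :: Q) else 0).
transitivity (\sum_(P <- blocks t) G' P).
  rewrite -/(blocks t) big_flatten big_map; apply: eq_bigr => P _ /=.
  by rewrite big_cons /G'; case: P => [|b Q]; rewrite ?big_nil ?big_seq1.
rewrite big_split; congr (_ + _).
by rewrite (IH _ (fun P => if P is b :: Q then G ((x :: b) :: Q) else 0)).
Qed.

Lemma mcomp_nil g f : mcomp g f [::] = g [::].
Proof. by rewrite /mcomp big_seq1. Qed.

Lemma mcomp_cons g f x s :
  mcomp g f (x :: s) = ncsum (fun a b => mcomp (fun t => g (f a :: t)) f b) (x :: s).
Proof. exact: big_blocks_cons. Qed.

Lemma mcompE g f s : (0 < size s)%N ->
  mcomp g f s = ncsum (fun a b => mcomp (fun t => g (f a :: t)) f b) s.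
Proof. by case: s => // x s _; apply: mcomp_cons. Qed.

Lemma eq_mcomp g g' f f' s :
    (forall P, flatten P = s -> all (fun b => 0 < size b)%N P ->
      g (map f P) = g' (map f' P)) ->
  mcomp g f s = mcomp g' f' s.
Proof.
have [n] := ubnP (size s); elim: n s g g' => // n IH [|x s] g g' sz h.
  by rewrite !mcomp_nil; apply: (h [::]).
rewrite !mcomp_cons; apply: eq_ncsum => y a b [-> e].
apply: IH => [|P fP hP].
  by move: sz; rewrite -e /= size_cat ltnS; apply: leq_ltn_trans; apply: leq_addl.
by apply: (h ((x :: a) :: P)); rewrite //= fP e.
Qed.

Lemma mcompDl g g' f s :
  mcomp (fun t => g t + g' t) f s = mcomp g f s + mcomp g' f s.
Proof. exact: big_split. Qed.

Lemma mcomp_sum I (r : seq I) (g : I -> seq V' -> W) f s :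
  mcomp (fun t => \sum_(i <- r) g i t) f s = \sum_(i <- r) mcomp (g i) f s.
Proof. exact: exchange_big. Qed.

(** A coalgebra map is compatible with deconcatenation. *)
Lemma mcomp_csum (G : seq V' -> seq V' -> W) f s :
  mcomp (fun t => csum G t) f s =
  csum (fun a b => \sum_(P <- blocks a) \sum_(Q <- blocks b)
                     G (map f P) (map f Q)) s.
Proof.
have [n] := ubnP (size s); elim: n s G => // n IH [|x s] G sz.
  by rewrite mcomp_nil /= !big_seq1 /= !addr0.
rewrite csumE big_seq1 mcomp_cons /=.
transitivity (csum (fun a b => mcomp (fun t => G [::] (f (x :: a) :: t)) f b) s +
   csum (fun a b => mcomp (fun t => csum (fun p q => G (f (x :: a) :: p) q) t) f b) s).
  by rewrite -csumD; apply: eq_csum => a b _; rewrite -mcompDl.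
congr (_ + _); first by rewrite big_blocks_cons.
under [RHS]eq_csum do rewrite big_blocks_cons.
rewrite -csum_assoc; apply: eq_csum => a b e.
rewrite IH // ; move: sz; rewrite -e /= size_cat ltnS.
by apply: leq_ltn_trans; apply: leq_addl.
Qed.

Lemma mcomp_ncsum (G : seq V' -> seq V' -> W) f s :
  mcomp (fun t => ncsum G t) f s =
  ncsum (fun a b => \sum_(P <- blocks a) \sum_(Q <- blocks b)
                     G (map f P) (map f Q)) s.
Proof.
have E : mcomp (fun t => csum G t) f s =
   mcomp (G [::]) f s + mcomp (fun t => ncsum G t) f s.
  by rewrite -mcompDl; apply: eq_bigr => P _; rewrite csumE.
by apply: (@addrI _ (mcomp (G [::]) f s)); rewrite -E mcomp_csum csumE big_seq1.
Qed.

Lemma big_blocks_multilinear (G : seq (seq V) -> W) :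
    (forall P Q, multilinear (fun b => G (P ++ b :: Q))) ->
  multilinear (fun s => \sum_(P <- blocks s) G P).
Proof.
have E z (H : seq (seq V) -> W) s : \sum_(P <- blocks (z :: s)) H P =
    \sum_(P <- blocks s) (H ([:: z] :: P) +
       (if P is b :: Q then H ((z :: b) :: Q) else 0)).
  rewrite /= big_flatten big_map; apply: eq_bigr => P _.
  by rewrite big_cons; case: P => [|b Q]; rewrite ?big_nil ?big_seq1.
move=> hG s1; elim: s1 G hG => [|z s1 IH] G hG s2 a x y.
  rewrite !E scaler_sumr -big_split; apply: eq_bigr => P _ /=.
  rewrite (hG [::] P [::] [::]) /= scalerDr addrACA; congr (_ + _).
  case: P => [|b Q]; first by rewrite scaler0 addr0.
  exact: (hG [::] Q [::]).
rewrite /= !E -/cat; apply: IH => P Q t1 t2 c u v.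
rewrite (hG ([:: z] :: P)) scalerDr addrACA; congr (_ + _).
case: P => [|b P] /=; last exact: (hG ((z :: b) :: P)).
exact: (hG [::] Q (z :: t1)).
Qed.

Lemma mcomp_multilinear g f :
  multilinear g -> multilinear f -> multilinear (mcomp g f).
Proof.
move=> hg hf; apply: big_blocks_multilinear => P Q s1 s2 a x y.
by rewrite !map_cat /= hf hg.
Qed.

Lemma mcomp_sum_head I (r : seq I) (v : I -> V') g f s : multilinear g ->
  mcomp (fun t => g ((\sum_(i <- r) v i) :: t)) f s =
  \sum_(i <- r) mcomp (fun t => g (v i :: t)) f s.
Proof.
move=> hg; rewrite -mcomp_sum; apply: eq_bigr => P _.
exact: (multilinear_sum [::]).
Qed.

End Composition.

Section CompositionLaws.
Variables (K : fieldType).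

Lemma mcomp_linear (V V' W W' : lmodType K) (phi : {linear W -> W'})
    (g : seq V' -> W) (f : seq V -> V') s :
  mcomp (fun t => phi (g t)) f s = phi (mcomp g f s).
Proof. by rewrite /mcomp raddf_sum. Qed.

Lemma mcomp_assoc (V V' V'' W : lmodType K) (g : seq V'' -> W)
    (f : seq V' -> V'') (k : seq V -> V') s : multilinear g ->
  mcomp (mcomp g f) k s = mcomp g (mcomp f k) s.
Proof.
have [n] := ubnP (size s); elim: n s g => // n IH [|x s] g sz hg.
  by rewrite !mcomp_nil.
have E : mcomp (mcomp g f) k (x :: s) =
    mcomp (fun t => ncsum (fun a b => mcomp (fun t => g (f a :: t)) f b) t) k (x :: s).
  by apply: eq_mcomp => -[|b P] //= _ _; rewrite mcomp_cons.
rewrite E mcomp_ncsum mcomp_cons; apply: eq_ncsum => y a b [_ e].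
rewrite mcomp_sum_head //; apply: eq_bigr => P _.
rewrite -[LHS]/(mcomp (mcomp (fun t => g (f (map k P) :: t)) f) k b).
apply: IH; last exact: multilinear_cons.
by move: sz; rewrite -e /= size_cat ltnS; apply: leq_ltn_trans; apply: leq_addl.
Qed.

(** The identity morphism, as a family. *)
Definition mid (V : lmodType K) (s : seq V) : V := if s is [:: x] then x else 0.

Definition unary (V : lmodType K) (u : V -> V) (s : seq V) : V :=
  if s is [:: x] then u x else 0.

(** The morphism equation only says that the coalgebra map F and the
    coderivations agree after projection to V'; since both are determined by
    this projection, they then agree on the tensor coalgebra, hence under any
    multilinear g.  The proof splits off the first block: the insertion takes
    place either inside it or to its right. *)
Lemma minsert_mcomp (V V' W : lmodType K) (e : V -> V) (e' : V' -> V')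
    (m : seq V -> V) (m' : seq V' -> V') (f : seq V -> V') (g : seq V' -> W) s :
    multilinear g ->
    (forall s, f (map e s) = e' (f s)) ->
    (forall x s, mcomp m' f (x :: s) = minsert e f m (x :: s)) ->
  mcomp (minsert e' g m') f s = minsert e (mcomp g f) m s.
Proof.
move=> hg fe fm; have [n] := ubnP (size s); elim: n s g hg => // n IH s g hg.
case: s => [|x s] sz; first by rewrite mcomp_nil.
have E1 : mcomp (minsert e' g m') f (x :: s) =
  mcomp (fun t => ncsum (fun b c => g (m' b :: c)) t) f (x :: s) +
  mcomp (fun t => if t is v :: t' then minsert e' (fun t => g (e' v :: t)) m' t'
                  else 0) f (x :: s).
  by rewrite -mcompDl; apply: eq_mcomp => -[|b P] //= _ _; rewrite addr0.
have E2 : minsert e (mcomp g f) m (x :: s) =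
  minsert e (fun t => ncsum (fun a b => mcomp (fun t => g (f a :: t)) f b) t)
     m (x :: s).
  by apply: eq_minsert => y a b c _; rewrite mcompE // size_cat addnS.
rewrite {}E1 {}E2 minsert_ncsum ncsumD mcomp_ncsum; congr (_ + _).
  apply: eq_ncsum => y a b _.
  transitivity (mcomp (fun t => g (mcomp m' f (y :: a) :: t)) f b).
    by rewrite mcomp_sum_head.
  rewrite fm; apply: (@minsert_morph _ _ _ _
    (fun v : V' => mcomp (fun t => g (v :: t)) f b)) => u v.
  rewrite -mcompDl; apply: eq_bigr => P _.
  exact: (multilinear_morph [::] _ hg).
rewrite mcomp_cons; apply: eq_ncsum => y a b [_ e1].
rewrite fe; apply: IH; first exact: multilinear_cons.
by move: sz; rewrite -e1 /= size_cat ltnS; apply: leq_ltn_trans; apply: leq_addl.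
Qed.

End CompositionLaws.

(** * The square of an odd coderivation *)

Section Anticommutator.
Variables (K : fieldType) (V W : lmodType K) (e : V -> V).
Hypothesis ee : involutive e.

Definition odd_map (m : seq V -> V) :=
  forall x s, m (map e (x :: s)) = - e (m (x :: s)).

(** Either the two insertions are nested in the block that contains the first
    letter, or one of them contains it and the other lies to the right, or both
    lie to the right.  The middle terms come with opposite signs. *)
Lemma minsert_minsert_cons (g : seq V -> W) (m1 m2 : seq V -> V) x s :
    multilinear g -> odd_map m1 ->
  minsert e (minsert e g m1) m2 (x :: s) =
    ncsum (fun b c => g (minsert e m1 m2 b :: c)) (x :: s) +
    (ncsum (fun b c => minsert e (fun t => g (e (m2 b) :: t)) m1 c) (x :: s) -
     ncsum (fun b c => minsert e (fun t => g (e (m1 b) :: t)) m2 c) (x :: s)) +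
    minsert e (minsert e (fun t => g (x :: t)) m1) m2 s.
Proof.
move=> hg o1.
have E : ncsum (fun b c => g (minsert e m1 m2 b :: c)) (x :: s) =
    ncsum (fun b c => csum (fun p q => g (m1 (m2 b :: p) :: q)) c) (x :: s) +
    csum (fun p q => minsert e (fun p => g (m1 (e x :: p) :: q)) m2 p) s.
  rewrite ncsum_assoc /= -csumD; apply: eq_csum => p q _.
  rewrite (multilinear_morph [::] q hg); congr (_ + _).
    exact: (csum_morph _ _ (multilinear_morph [::] q hg)).
  exact: (minsert_morph _ _ _ _ (multilinear_morph [::] q hg)).
have E3 : minsert e (fun t => csum (fun p q => g (m1 (e x :: p) :: q)) t) m2 s =
   csum (fun p q => minsert e (fun p => g (m1 (e x :: p) :: q)) m2 p) s -
   ncsum (fun b c => minsert e (fun t => g (e (m1 b) :: t)) m2 c) (x :: s).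
  rewrite minsert_csum csumD; congr (_ + _) => /=.
  rewrite [RHS](csum_morph _ _ (@opprD W)); apply: eq_csum => p q _.
  rewrite (minsert_morph _ _ _ _ (@opprD W)).
  by apply: eq_minsert => y a b c _; rewrite o1 (multilinearN [::]).
rewrite minsert_cons E.
have -> : ncsum (fun b c => minsert e g m1 (m2 b :: c)) (x :: s) =
    ncsum (fun b c => csum (fun p q => g (m1 (m2 b :: p) :: q)) c) (x :: s) +
    ncsum (fun b c => minsert e (fun t => g (e (m2 b) :: t)) m1 c) (x :: s).
  by rewrite -ncsumD.
have -> : minsert e (fun t => minsert e g m1 (e x :: t)) m2 s =
   minsert e (fun t => csum (fun p q => g (m1 (e x :: p) :: q)) t) m2 s +
   minsert e (minsert e (fun t => g (x :: t)) m1) m2 s.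
  rewrite -minsertDl; apply: eq_minsert => *; by rewrite /= ee.
rewrite E3 !addrA; congr (_ + _).
by rewrite -!addrA; congr (_ + _); rewrite addrCA !addrA.
Qed.

(** The anticommutator of two odd coderivations is an even coderivation. *)
Lemma minsert_anticomm (g : seq V -> W) (m1 m2 : seq V -> V) s :
    multilinear g -> odd_map m1 -> odd_map m2 ->
  minsert e (minsert e g m1) m2 s + minsert e (minsert e g m2) m1 s =
  minsert id g (fun t => minsert e m1 m2 t + minsert e m2 m1 t) s.
Proof.
move=> hg o1 o2; elim: s g hg => [|x s IH] g hg; first by rewrite /= addr0.
rewrite !minsert_minsert_cons // minsert_cons -IH; last exact: multilinear_cons.
rewrite addrACA; congr (_ + _).
rewrite addrACA -ncsumD [X in _ + X](_ : _ = 0) ?addr0.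
  apply: eq_ncsum => y a b _.
  by rewrite -(multilinear_morph [::] b hg).
by rewrite addrA subrK subrr.
Qed.

Lemma minsert_square (g : seq V -> W) (m : seq V -> V) s :
    (2 : K) != 0 -> multilinear g -> odd_map m ->
    (forall x s, minsert e m m (x :: s) = 0) ->
  minsert e (minsert e g m) m s = 0.
Proof.
move=> two hg om mm; have := minsert_anticomm s hg om om.
rewrite [RHS](_ : _ = 0) => [/eqP|].
  by rewrite -mulr2n -scaler_nat scaler_eq0 (negPf two) => /eqP.
rewrite -(@minsert0r _ _ _ id g s) //; apply: eq_minsert => x a b c _.
by rewrite mm addr0.
Qed.

End Anticommutator.

(** * The identity and morphisms close to it *)

Section Identity.
Variables (K : fieldType).

Lemma mid_multilinear (V : lmodType K) : multilinear (@mid K V).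
Proof.
move=> [|z [|z' s1]] s2 a x y; rewrite /mid /=.
- by case: s2 => [|w s2] //; rewrite scaler0 addr0.
- by rewrite scaler0 addr0.
- by rewrite scaler0 addr0.
Qed.

Lemma mcomp_midr (V W : lmodType K) (g : seq V -> W) s : multilinear g ->
  mcomp g (@mid K V) s = g s.
Proof.
elim: s g => [|x s IH] g hg; first by rewrite mcomp_nil.
rewrite mcomp_cons /= csumE IH; last exact: multilinear_cons.
rewrite [X in _ + X](_ : _ = 0) ?addr0 //.
rewrite -[RHS](ncsum0 _ s); apply: eq_ncsum => y a b _ /=.
rewrite /mcomp big1 // => P _; exact: (multilinear0 [::]).
Qed.

Lemma mcomp_midl (V V' : lmodType K) (f : seq V -> V') x s :
  mcomp (@mid K V') f (x :: s) = f (x :: s).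
Proof.
rewrite [LHS]big_blocks_cons csum_last => [|a y b _].
  by rewrite big_seq1.
by rewrite big_blocks_cons -[RHS](csum0 _ b); apply: eq_csum => *; rewrite big1.
Qed.

Lemma minsert_midl (V : lmodType K) e (m : seq V -> V) x s :
  minsert e (@mid K V) m (x :: s) = m (x :: s).
Proof.
rewrite /= csum_last // -[RHS]addr0; congr (_ + _).
rewrite -[RHS](minsert0l _ e m s); apply: eq_minsert => y [|z a] b c _ //.
Qed.

End Identity.

Section Arity.
Variables (K : fieldType).

Lemma eq_mcomp_size (V V' W : lmodType K) (g g' : seq V' -> W)
    (f f' : seq V -> V') n s : (size s <= n)%N ->
    (forall t, (size t <= n)%N -> g t = g' t) ->
    (forall t, (size t <= n)%N -> f t = f' t) ->
  mcomp g f s = mcomp g' f' s.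
Proof.
move=> sn hg hf; apply: eq_mcomp => P fP hP.
have sP : (size P <= n)%N.
  apply: leq_trans sn; rewrite -fP {fP}; elim: P hP => //= b P IH /andP[b0 /IH].
  by rewrite size_cat => h; rewrite -add1n leq_add.
rewrite hg ?size_map //; congr (g' _).
have : (size (flatten P) <= n)%N by rewrite fP.
elim: {fP hP sP} P => //= b P IH; rewrite size_cat => h.
rewrite hf ?IH //; apply: leq_trans h; [exact: leq_addl | exact: leq_addr].
Qed.

(** In arity n a decomposition into blocks either consists of letters, or of a
    single block, or contains a block of intermediate length, on which f
    vanishes. *)
Lemma mcomp_near_id (V W : lmodType K) (g : seq V -> W) (f : seq V -> V) n s :
    multilinear g -> (1 < n)%N ->
    (forall t, (size t < n)%N -> f t = mid t) -> size s = n ->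
  mcomp g f s = g [:: f s] + g s.
Proof.
move=> hg n1 fid; case: s => [|x s] sz; first by rewrite -sz in n1.
pose r t := f t - mid t.
rewrite [LHS]big_blocks_cons.
have E : csum (fun a b => mcomp (fun t => g (f (x :: a) :: t)) f b) s =
   csum (fun a b => mcomp (fun t => g (mid (x :: a) :: t)) f b) s +
   csum (fun a b => mcomp (fun t => g (r (x :: a) :: t)) f b) s.
  rewrite -csumD; apply: eq_csum => a b _.
  rewrite -mcompDl; apply: eq_bigr => P _.
  by rewrite -(multilinear_morph [::] _ hg) addrC subrK.
rewrite [LHS]E addrC csum_last => [|a y b e]; last first.
  rewrite /r fid; last by rewrite -sz -e /= size_cat /= addnS ltnS ltnS leq_addr.
  by rewrite subrr /mcomp big1 // => P _; apply: (multilinear0 [::]).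
rewrite mcomp_nil; case: s sz E => [|y s] sz E; first by rewrite -sz in n1.
rewrite /r subr0; congr (_ + _).
rewrite csumE [X in _ + X](_ : _ = 0) ?addr0; last first.
  rewrite -[RHS](ncsum0 _ (y :: s)); apply: eq_ncsum => z a b _.
  by rewrite /mcomp big1 // => P _; apply: (multilinear0 [::]).
transitivity (mcomp (fun t => g (x :: t)) (@mid K V) (y :: s)).
  apply: (@eq_mcomp_size _ _ _ _ _ _ _ (size (y :: s))) => // t st.
  by apply: fid; rewrite -sz ltnS.
by rewrite mcomp_midr //; apply: multilinear_cons.
Qed.

Lemma mcomp_below (V V' W : lmodType K) (g : seq V' -> W) (f : seq V -> V') n s :
    (forall t, (size t < n)%N -> g t = 0) -> (size s < n)%N ->
  mcomp g f s = 0.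
Proof.
case: n => // n hg sn.
rewrite -[RHS](_ : mcomp (fun=> 0 : W) f s = 0); last by rewrite /mcomp big1.
exact: (@eq_mcomp_size _ _ _ _ _ _ _ n).
Qed.

End Arity.

Section Inverse.
Variables (K : fieldType) (V : lmodType K).

(** Iteration towards the solution psi of psi = id + X o psi, that is the inverse
    of id - X.  It stabilizes when X has no linear part, since psi then enters
    the right hand side only through shorter sequences. *)
Fixpoint resolvent_approx (X : seq V -> V) n : seq V -> V :=
  if n is n'.+1 then fun s => mid s + mcomp X (resolvent_approx X n') s
  else fun=> 0.

Definition resolvent X s := resolvent_approx X (size s) s.

Variable X : seq V -> V.
Hypothesis Xml : multilinear X.
Hypothesis X_low : forall s, (size s < 2)%N -> X s = 0.

Lemma eq_mcomp_short (f f' : seq V -> V) n s : (size s <= n.+1)%N ->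
    (forall t, (size t <= n)%N -> f t = f' t) ->
  mcomp X f s = mcomp X f' s.
Proof.
move=> sn hf; apply: eq_mcomp => P fP hP.
have [P1|P2] := ltnP (size P) 2; first by rewrite !X_low ?size_map.
congr (X _); case: P P2 fP hP => // b [|c P] // _ fP /and3P[b0 c0 _].
have h : (size b + (size c + size (flatten P)) <= n.+1)%N.
  by rewrite -!size_cat; have -> : b ++ c ++ flatten P = s.
have hb : (size b <= n)%N.
  rewrite -ltnS; apply: leq_trans h; rewrite -addn1 leq_add2l.
  exact: leq_trans (leq_addr _ _).
have hc : (size c + size (flatten P) <= n)%N.
  by rewrite -ltnS; apply: leq_trans h; rewrite -add1n leq_add2r.
rewrite /= !hf //; last exact: leq_trans (leq_addr _ _) hc.
congr (_ :: _ :: _).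
have {hc} : (size (flatten P) <= n)%N by apply: leq_trans hc; apply: leq_addl.
elim: P {fP h} => //= d P IH; rewrite size_cat => hd.
rewrite hf ?IH //; apply: leq_trans hd; [exact: leq_addl | exact: leq_addr].
Qed.

Lemma resolvent_approx_stable n s : (size s <= n)%N ->
  resolvent_approx X n s = resolvent X s.
Proof.
have gen k n' t : (size t <= k)%N -> (k <= n')%N ->
    resolvent_approx X n' t = resolvent_approx X k t.
  elim: k n' t => [|k IH] [|n'] t //= tk kn.
    rewrite leqn0 in tk; rewrite (size0nil (eqP tk)) /= mcomp_nil X_low //.
    by rewrite addr0.
  congr (_ + _); apply: (eq_mcomp_short tk) => u uk; exact: IH.
by move=> sn; rewrite /resolvent (gen (size s) n).
Qed.

Lemma resolventE s : resolvent X s = mid s + mcomp X (resolvent X) s.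
Proof.
rewrite -(@resolvent_approx_stable (size s).+1) //=; congr (_ + _).
apply: (@eq_mcomp_short _ _ (size s)) => // t ts.
exact: resolvent_approx_stable.
Qed.

Lemma resolvent_multilinear : multilinear (resolvent X).
Proof.
have h n : multilinear (resolvent_approx X n).
  elim: n => [|n IH] s1 s2 a x y /=; first by rewrite scaler0 addr0.
  have := multilinear_comb 1 (@mid_multilinear K V) (mcomp_multilinear Xml IH).
  by move=> /(_ s1 s2 a x y); rewrite !scale1r.
move=> s1 s2 a x y.
pose n := (size (s1 ++ x :: s2)).
have e z : resolvent X (s1 ++ z :: s2) = resolvent_approx X n (s1 ++ z :: s2).
  by rewrite resolvent_approx_stable // /n !size_cat.
by rewrite !e h.
Qed.

End Inverse.

(** * Graded spaces *)

Definition mklinear (K : fieldType) (V W : lmodType K) (f : V -> W)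
  (fP : linear f) : {linear V -> W} :=
  HB.pack f (GRing.isLinear.Build K V W *:%R f fP).

Section Graded.
Variables (K : fieldType) (V : gradedSpace K).

Lemma homogZ d a (x : V) : homog d x -> homog d (a *: x).
Proof. by move=> hx; rewrite -[_ *: _]addr0; apply: homogP => //; apply: homog0. Qed.

Lemma homogD d (x y : V) : homog d x -> homog d y -> homog d (x + y).
Proof. by move=> hx hy; rewrite -[x]scale1r; apply: homogP. Qed.

Lemma homogN d (x : V) : homog d x -> homog d (- x).
Proof. by move=> hx; rewrite -scaleN1r; apply: homogZ. Qed.

Lemma homog_sum d I (r : seq I) (P : pred I) (F : I -> V) :
  (forall i, P i -> homog d (F i)) -> homog d (\sum_(i <- r | P i) F i).
Proof.
by move=> h; apply: big_ind => //; [apply: homog0 | move=> x y; apply: homogD].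
Qed.

Lemma homog_sum_seq d (I : eqType) (r : seq I) (F : I -> V) :
  (forall i, i \in r -> homog d (F i)) -> homog d (\sum_(i <- r) F i).
Proof. by move=> h; rewrite big_seq; apply: homog_sum. Qed.

Lemma homog_csum d (T : Type) (G : seq T -> seq T -> V) s :
  (forall a b, a ++ b = s -> homog d (G a b)) -> homog d (csum G s).
Proof.
elim: s G => [|x s IH] G h /=; apply: homogD; try exact: h.
  exact: homog0.
by apply: IH => a b e; apply: h; rewrite /= e.
Qed.

Lemma homog_ncsum d (T : Type) (G : seq T -> seq T -> V) s :
  (forall x a b, x :: a ++ b = s -> homog d (G (x :: a) b)) ->
  homog d (ncsum G s).
Proof.
case: s => [|x s] h /=; first exact: homog0.
by apply: homog_csum => a b e; apply: h; rewrite e.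
Qed.

(** Regrouping by degrees reduces the next lemma to the independence of the
    homogeneous components. *)
Lemma big_by_degree (W : lmodType K) (s : seq (int * V))
    (F : int * V -> W) :
  \sum_(t <- s) F t =
  \sum_(d <- undup (map fst s)) \sum_(t <- s | t.1 == d) F t.
Proof.
rewrite (exchange_big_dep xpredT) //= big_seq [RHS]big_seq.
apply: eq_bigr => t ts.
rewrite -big_filter (@perm_big _ _ _ _ _ [:: t.1]) ?big_seq1 //.
apply: uniq_perm; rewrite ?filter_uniq ?undup_uniq // => d.
rewrite mem_filter inE mem_undup eq_sym andb_idr // => /eqP->.
exact: map_f.
Qed.

Lemma graded_sum0 (W : lmodType K) (phi : int -> {linear V -> W})
    (s : seq (int * V)) : (forall t, t \in s -> homog t.1 t.2) ->
  \sum_(t <- s) t.2 = 0 -> \sum_(t <- s) phi t.1 t.2 = 0.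
Proof.
move=> hs s0; rewrite big_by_degree big_seq big1 // => d dd.
transitivity (phi d (\sum_(t <- s | t.1 == d) t.2)).
  by rewrite raddf_sum; apply: eq_bigr => t /eqP->.
rewrite (@homog_direct _ _ (undup (map fst s))
          (fun d => \sum_(t <- s | t.1 == d) t.2)) ?raddf0 ?undup_uniq //.
  move=> d'; rewrite big_seq_cond; apply: homog_sum => t /andP[ts /eqP<-].
  exact: hs.
by rewrite -(big_by_degree s (fun t => t.2)).
Qed.

(** Well defined, because a vanishing sum of homogeneous elements vanishes
    degree by degree. *)
Lemma graded_linear_ext (W : lmodType K) (phi : int -> {linear V -> W}) :
  exists F : {linear V -> W}, forall d x, homog d x -> F x = phi d x.
Proof.
have /choice[dec decP] (x : V) : exists s : seq (int * V),
    (forall t, t \in s -> homog t.1 t.2) /\ x = \sum_(t <- s) t.2.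
  by have [s h e] := homog_span x; exists s.
pose F x := \sum_(t <- dec x) phi t.1 t.2.
have FP : linear F.
  move=> a x y; apply/eqP; rewrite -subr_eq0; apply/eqP.
  pose s := dec (a *: x + y) ++ [seq (t.1, - (a *: t.2)) | t <- dec x] ++
            [seq (t.1, - t.2) | t <- dec y].
  have := @graded_sum0 _ phi s; rewrite /s !big_cat !big_map /=.
  rewrite !sumrN -!scaler_sumr -!(decP _).2 -opprD subrr => H.
  rewrite -[RHS]H // => [|t].
    rewrite opprD /F; congr (_ + (_ + _)); rewrite ?scaler_sumr -sumrN.
      by apply: eq_bigr => t _; rewrite -[in RHS]scaleNr [RHS]linearZ /= scaleNr.
    by apply: eq_bigr => t _; rewrite [RHS]raddfN.
  rewrite !mem_cat => /or3P[/(proj1 (decP _))//|/mapP[u]|/mapP[u]].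
    by move=> /(proj1 (decP _)) hu ->; apply/homogN/homogZ.
  by move=> /(proj1 (decP _)) hu ->; apply/homogN.
exists (mklinear FP) => d x hx /=.
have := @graded_sum0 _ phi ((d, - x) :: dec x).
rewrite !big_cons /= -(decP _).2 addNr raddfN => H.
apply/eqP; rewrite -subr_eq0 addrC; apply/eqP; apply: H => // t.
by rewrite inE => /orP[/eqP->|/(proj1 (decP _))//]; apply: homogN.
Qed.

(** The signs of the A-infinity relations become an operator, so that the
    relations make sense on inhomogeneous elements. *)
Definition parity : {linear V -> V} :=
  projT1 (cid (graded_linear_ext
    (fun d => [the {linear V -> V} of GRing.scale ((-1 : K) ^ d)]))).

Lemma parityE d (x : V) : homog d x -> parity x = (-1) ^ d *: x.
Proof. by move=> hx; rewrite /parity; case: cid => F /= h; rewrite (h d). Qed.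

Lemma sqr_sign (d : int) : (-1 : K) ^ d * (-1) ^ d = 1.
Proof. by rewrite -expfzMl mulrNN mulr1 exp1rz. Qed.

Lemma homog_ind (Q : V -> Prop) : Q 0 -> (forall x y, Q x -> Q y -> Q (x + y)) ->
  (forall d x, homog d x -> Q x) -> forall x, Q x.
Proof.
move=> Q0 QD Qh x; have [s hs ->] := homog_span x.
by rewrite big_seq; apply: big_ind => // t ts; apply: Qh (hs _ ts).
Qed.

Lemma parityK : involutive parity.
Proof.
move=> x; elim/homog_ind: x => [|x y hx hy|d x hx]; first by rewrite !raddf0.
  by rewrite !linearD hx hy.
by rewrite (parityE hx) linearZ /= (parityE hx) scalerA sqr_sign scale1r.
Qed.

Lemma homog_parity d x : homog d x -> homog d (parity x).
Proof. by move=> hx; rewrite (parityE hx); apply: homogZ. Qed.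

Lemma homog_spanning (x : V) : exists2 l : seq V,
  (forall y, y \in l -> exists d, homog d y) & x = \sum_(y <- l) y.
Proof.
have [s hs ->] := homog_span x; exists (map snd s); last by rewrite big_map.
by move=> y /mapP[t /hs ht ->]; exists t.1.
Qed.

(** The underlying sequences of homogeneous words: a sequence may be homogeneous
    for several D, because zero has every degree. *)
Definition hseq D (s : seq V) :=
  exists w : word V, [/\ homog_word w, wvec w = s & wdeg w = D].

Lemma hseq_cat D (a b : seq V) : hseq D (a ++ b) ->
  exists D1 D2, [/\ D1 + D2 = D, hseq D1 a & hseq D2 b].
Proof.
move=> [w [hw ew <-]].
exists (wdeg (take (size a) w)), (wdeg (drop (size a) w)); split.
- by rewrite /wdeg -big_cat cat_take_drop.
- exists (take (size a) w); split=> // [t /mem_take|]; first exact: hw.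
  by rewrite /wvec /unzip2 map_take -/(unzip2 w) -/(wvec w) ew take_size_cat.
- exists (drop (size a) w); split=> // [t /mem_drop|]; first exact: hw.
  by rewrite /wvec /unzip2 map_drop -/(unzip2 w) -/(wvec w) ew drop_size_cat.
Qed.

Lemma cat_hseq D1 D2 (a b : seq V) : hseq D1 a -> hseq D2 b ->
  hseq (D1 + D2) (a ++ b).
Proof.
move=> [w1 [h1 <- <-]] [w2 [h2 <- <-]]; exists (w1 ++ w2); split.
- by move=> t; rewrite mem_cat => /orP[/h1|/h2].
- by rewrite /wvec /unzip2 map_cat.
- by rewrite /wdeg big_cat.
Qed.

Lemma hseq1 d (x : V) : homog d x -> hseq d [:: x].
Proof.
move=> hx; exists [:: (d, x)]; split=> // [t|]; last by rewrite /wdeg big_seq1.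
by rewrite inE => /eqP->.
Qed.

Lemma hseq_cons D1 D2 x (b : seq V) : homog D1 x -> hseq D2 b ->
  hseq (D1 + D2) (x :: b).
Proof. by move=> hx hb; apply: (@cat_hseq _ _ [:: x]) => //; apply: hseq1. Qed.

Lemma hseq_nil D : hseq D [::] -> D = 0.
Proof. by move=> [[|t w] [_ // _ <-]]; rewrite /wdeg big_nil. Qed.

Lemma hseq_map (u : V -> V) D s : (forall d x, homog d x -> homog d (u x)) ->
  hseq D s -> hseq D (map u s).
Proof.
move=> hu [w [hw <- <-]]; exists [seq (t.1, u t.2) | t <- w]; split.
- by move=> t /mapP[v /hw hv ->]; apply: hu.
- by rewrite /wvec /unzip2 -!map_comp.
- by rewrite /wdeg big_map.
Qed.

Lemma hseq_exists (s : seq V) : (forall y, y \in s -> exists d, homog d y) ->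
  exists D, hseq D s.
Proof.
elim: s => [|x s IH] h; first by exists 0, [::]; split; rewrite ?/wdeg ?big_nil.
have [|D hD] := IH; first by move=> y ys; apply: h; rewrite inE ys orbT.
by have [d hd] := h x (mem_head _ _); exists (d + D); apply: hseq_cons.
Qed.

Lemma parity_hseq (W : lmodType K) (f : seq V -> W) D s : multilinear f ->
  hseq D s -> f (map parity s) = (-1) ^ D *: f s.
Proof.
move=> hf [w [hw <- <-]] {D s}; elim: w f hf hw => [|[d x] w IH] f hf hw.
  by rewrite /wdeg big_nil expr0z scale1r.
rewrite /= (parityE (hw _ (mem_head _ _))) (multilinearZ [::]) //=.
rewrite (IH (fun t => f (x :: t))) ?scalerA; first last.
- by move=> t tw; apply: hw; rewrite inE tw orbT.
- exact: multilinear_cons.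
by rewrite /wdeg big_cons /= expfzDr ?oppr_eq0 ?oner_eq0.
Qed.

End Graded.

Section Degrees.
Variables (K : fieldType).

Lemma has_degreeP (V W : gradedSpace K) e (f : seq V -> W) :
  has_degree e f <->
  (forall D x s, hseq D (x :: s) -> homog (D + e) (f (x :: s))).
Proof.
split=> h; first by move=> D x s [[|t w] [hw // <- <-]]; apply: h.
by case=> // t w _ hw; apply: h; exists (t :: w).
Qed.

Lemma homog_image (V W : gradedSpace K) e (f : seq V -> W) D x s :
  has_degree e f -> hseq D (x :: s) -> homog (D + e) (f (x :: s)).
Proof. by move=> /has_degreeP; apply. Qed.

Lemma mem_blocks (T : eqType) (s : seq T) P : P \in blocks s ->
  flatten P = s /\ all (fun b => 0 < size b)%N P.
Proof.
elim: s P => [|x s IH] P; first by rewrite inE => /eqP->.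
move=> /flattenP[l /mapP[Q /IH[<- hQ] ->]].
rewrite inE => /orP[/eqP->|] //=.
by case: Q hQ => //= b Q /andP[_ hQ]; rewrite inE => /eqP->.
Qed.

Lemma mcomp_degree (V V' W : gradedSpace K) e (g : seq V' -> W)
    (f : seq V -> V') :
  has_degree e g -> has_degree 0 f -> has_degree e (mcomp g f).
Proof.
rewrite !has_degreeP => hg hf D x s hD.
apply: homog_sum_seq => P /mem_blocks[fP hP].
have hPD : hseq D (map f P).
  rewrite -fP in hD; elim: P hP D hD {fP} => [|[|y b] P IH] //= hP D hD.
    by rewrite (hseq_nil hD); exists [::]; split; rewrite // /wdeg big_nil.
  have [D1 [D2 [<- h1 h2]]] := @hseq_cat _ _ _ (y :: b) _ hD.
  by rewrite -[D1]addr0; apply: hseq_cons; [apply: hf | apply: IH].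
by case: P fP hPD {hP} => // b P _; apply: hg.
Qed.

Lemma minsert_degree (V W : gradedSpace K) e1 e2 (u : V -> V) (g : seq V -> W)
    (m : seq V -> V) : (forall d x, homog d x -> homog d (u x)) ->
  has_degree e1 g -> has_degree e2 m -> has_degree (e1 + e2) (minsert u g m).
Proof.
move=> hu; rewrite !has_degreeP => hg hm D x s hD.
rewrite minsertE; apply: homog_csum => a t e; apply: homog_ncsum => y b c e'.
rewrite -{}e -{}e' -cat_cons in hD.
have [D1 [D2 [<- h1 /hseq_cat[D3 [D4 [<- /hm h3 h4]]]]]] := hseq_cat hD.
have -> : D1 + (D3 + D4) + (e1 + e2) = D1 + ((D3 + e2) + D4) + e1.
  by rewrite -!addrA [e1 + e2]addrC [e2 + (D4 + _)]addrCA.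
have := cat_hseq (hseq_map hu h1) (hseq_cons h3 h4).
by case: (map u a) => [|z a'] /= => /hg.
Qed.

(** A multilinear family of degree e commutes with the parity up to (-1)^e:
    both sides agree on homogeneous sequences, which is enough. *)
Lemma parity_map (V W : gradedSpace K) e (f : seq V -> W) x s :
  multilinear f -> has_degree e f ->
  f (map (parity V) (x :: s)) = (-1) ^ e *: parity W (f (x :: s)).
Proof.
move=> hf /has_degreeP df.
apply: (multilinear_ext (n := (size s).+1) (f := fun s => f (map (parity V) s))
  (g := fun s => (-1) ^ e *: parity W (f s)) (@homog_spanning _ V)) => //.
- exact: multilinear_map.
- move=> s1 s2 a y z; rewrite hf linearP scalerDr !scalerA.
  by rewrite [(-1) ^ e * a]mulrC.
case=> // y t _ /hseq_exists[D hD].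
rewrite (parity_hseq hf hD) (parityE (df _ _ _ hD)) scalerA.
by rewrite mulrC expfzDr ?oppr_eq0 ?oner_eq0 // -mulrA sqr_sign mulr1.
Qed.

Lemma even_map (V W : gradedSpace K) (f : seq V -> W) :
  multilinear f -> has_degree 0 f -> f [::] = 0 ->
  forall s, f (map (parity V) s) = parity W (f s).
Proof.
move=> mlf df f0 [|x s]; first by rewrite f0 linear0.
by rewrite (parity_map _ _ mlf df) expr0z scale1r.
Qed.

Lemma mid_degree (V : gradedSpace K) : has_degree 0 (@mid K V).
Proof.
apply/has_degreeP => D x [|y s] hD; last exact: homog0.
have [[|[d v] [|t w]] [hw // [<-] <-]] := hD.
by rewrite /wdeg big_seq1 addr0; apply: (hw (d, v)); apply: mem_head.
Qed.

End Degrees.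

(** * Complements and generalized inverses *)

Section Complements.
Variables (K : fieldType) (V : lmodType K).

Definition subspace (U : V -> Prop) :=
  U 0 /\ forall a x y, U x -> U y -> U (a *: x + y).

(** Zorn: if A is maximal among the subspaces that meet U in 0, and v were not
    in U + A, then A could be enlarged by v. *)
Lemma maximal_complement (U : V -> Prop) : subspace U ->
  exists A : V -> Prop, [/\ subspace A, forall x, A x -> U x -> x = 0 &
    forall v, exists2 u, U u & A (v - u)].
Proof.
move=> [U0 UP].
(* Zero is not required, since the union of the empty chain is empty. *)
pose good (X : set V) := (forall a x y, X x -> X y -> X (a *: x + y)) /\
  (forall x, X x -> U x -> x = 0).
have [F FP Ftot|A [[AP AU] Amax]] := @Zorn_bigcup V good.
  split=> [a x y [X FX Xx] [Y FY Yy]|x [X /FP[_ h]]]; last exact: h.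
  have [XY|YX] := Ftot X Y FX FY.
    by exists Y => //; apply: (FP Y FY).1 => //; apply: XY.
  by exists X => //; apply: (FP X FX).1 => //; apply: YX.
pose A0 x := A x \/ x = 0.
have A0P a x y : A0 x -> A0 y -> A0 (a *: x + y).
  move=> [Ax|->]; last by rewrite scaler0 add0r.
  move=> [Ay|->]; left; apply: (AP) => //.
  by have := AP (-1) x x Ax Ax; rewrite scaleN1r addNr.
have A0U x : A0 x -> U x -> x = 0 by case=> // /AU.
exists A0; split=> // [|v]; first by split=> //; right.
apply: contrapT => hv.
pose B : set V := fun x => exists a, exists2 w, A0 w & x = a *: v + w.
apply: (Amax B); last first.
  split=> [a x y [b [w Aw ->]] [c [z Az ->]]|x [a [w Aw ->]] Ux].
    exists (a * b + c), (a *: w + z); first exact: A0P.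
    by rewrite scalerDr scalerDl scalerA addrACA.
  have [a0|a0] := eqVneq a 0.
    by move: Ux; rewrite a0 scale0r add0r; apply: A0U.
  case: hv; exists (v + a^-1 *: w).
    have := UP a^-1 _ _ Ux U0.
    by rewrite addr0 scalerDr scalerA mulVf // scale1r.
  rewrite opprD addNKr -scaleNr -[_ *: w]addr0.
  by apply: A0P => //; right.
split=> [x Ax|BA]; first by exists 0, x; [left | rewrite scale0r add0r].
case: hv; exists 0 => //; rewrite subr0; left; apply: BA.
by exists 1, 0; [right | rewrite scale1r addr0].
Qed.

Lemma subspace_projection (U : V -> Prop) : subspace U ->
  exists p : {linear V -> V}, (forall x, U (p x)) /\ forall x, U x -> p x = x.
Proof.
move=> hU; have [A [[A0 AP] AU hA]] := maximal_complement hU.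
have [U0 UP] := hU.
have /choice[p pP] v : exists u, U u /\ A (v - u) by have [u] := hA v; exists u.
have uniq_p v u : U u -> A (v - u) -> p v = u.
  move=> Uu Au; apply/eqP; rewrite -subr_eq0; apply/eqP; apply: AU.
    have := AP (-1) _ _ (pP v).2 Au.
    by rewrite scaleN1r opprB addrA subrK.
  by have := UP (-1) _ _ Uu (pP v).1; rewrite scaleN1r addrC.
have lp : linear p.
  move=> a x y; apply: uniq_p; first exact: UP (pP _).1 (pP _).1.
  rewrite opprD addrACA -scalerBr.
  exact: AP (pP _).2 (pP _).2.
exists (mklinear lp); split=> x /=; first exact: (pP x).1.
by move=> Ux; apply: uniq_p; rewrite ?subrr.
Qed.

(** Choose a complement of the kernel, on which d is injective, and a projection
    onto the image. *)
Lemma generalized_inverse (d : {linear V -> V}) :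
  exists h : {linear V -> V}, forall x, d (h (d x)) = d x.
Proof.
have [|pZ [pZ1 pZ2]] := @subspace_projection (fun x => d x = 0).
  by split=> [|a x y dx dy]; rewrite ?raddf0 // linearP dx dy scaler0 addr0.
have [|pB [pB1 pB2]] := @subspace_projection (fun x => exists y, x = d y).
  split=> [|a x y [u ->] [v ->]]; first by exists 0; rewrite raddf0.
  by exists (a *: u + v); rewrite linearP.
have /choice[sec secP] x : exists y, pB x = d y by apply: pB1.
pose q x := x - pZ x.
have dq x : d (q x) = d x by rewrite /q linearB pZ1 subr0.
have qP a x y z : d z = a *: d x + d y -> q z = a *: q x + q y.
  move=> e; have /pZ2 : d (z - (a *: x + y)) = 0 by rewrite linearB linearP e subrr.
  rewrite /q linearB linearP /= scalerBr addrACA -opprD.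
  move: (a *: x + y) (a *: pZ x + pZ y) => u v e2; apply/eqP.
  by rewrite subr_eq -addrA [- v + _]addrC e2 addrC subrK.
have lh : linear (fun x => q (sec x)).
  by move=> a x y; apply: qP; rewrite -!secP linearP.
exists (mklinear lh) => x /=.
by rewrite dq -secP pB2 //; exists x.
Qed.

End Complements.

Section GradedInverse.
Variables (K : fieldType) (V : gradedSpace K).

Definition linear_degree (e : int) (u : V -> V) :=
  forall k x, homog k x -> homog (k + e) (u x).

Lemma component (e : int) : exists c : {linear V -> V},
  (forall k x, homog k x -> c x = if k == e then x else 0) /\
  forall x, homog e (c x).
Proof.
have lc k : linear (fun x : V => if k == e then x else 0).
  by move=> a x y; case: ifP; rewrite // scaler0 addr0.
have [c hc] := graded_linear_ext (fun k => mklinear (lc k)).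
exists c; split=> [|x]; first by move=> k x /hc.
elim/homog_ind: x => [|x y hx hy|k x hx].
- by rewrite raddf0; apply: homog0.
- by rewrite raddfD; apply: homogD.
- by rewrite (hc k) //=; case: eqP => [<-|_]; last apply: homog0.
Qed.

(** The component of degree -1 of a generalized inverse of a map of degree 1 is
    again a generalized inverse. *)
Lemma graded_inverse (d : {linear V -> V}) : linear_degree 1 d ->
  exists2 h : {linear V -> V}, linear_degree (-1) h &
    forall x, d (h (d x)) = d x.
Proof.
move=> d1; have [g hg] := generalized_inverse d.
have /choice[c cP] e := component e.
have [h hP] := graded_linear_ext
  (fun k => [the {linear V -> V} of (c (k - 1) \o g)]).
exists h => [k x hx|x]; first by rewrite (hP k) //=; apply: (cP _).2.
have dc e y : d (c e y) = c (e + 1) (d y).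
  elim/homog_ind: y => [|y z hy hz|k y hy]; first by rewrite !linear0.
    by rewrite !linearD hy hz.
  rewrite ((cP e).1 k) // ((cP (e + 1)).1 (k + 1)) ?(inj_eq (addIr _)); last exact: d1.
  by case: ifP; rewrite ?raddf0.
elim/homog_ind: x => [|x y hx hy|k x hx]; first by rewrite !linear0.
  by rewrite !linearD hx hy.
have dx := d1 _ _ hx.
by rewrite (hP (k + 1)) //= addrK dc hg ((cP _).1 (k + 1)) // eqxx.
Qed.

Lemma parity_odd (e : int) (u : {linear V -> V}) : linear_degree e u ->
  (-1) ^ e = -1 :> K -> forall x, u (parity V x) = - parity V (u x).
Proof.
move=> ue sg; elim/homog_ind=> [|x y hx hy|k x hx]; first by rewrite !linear0.
  by rewrite !linearD hx hy.
rewrite (parityE hx) linearZ /= (parityE (ue _ _ hx)) expfzDr ?oppr_eq0 ?oner_eq0 //.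
by rewrite sg mulrN1 scaleNr opprK.
Qed.

Lemma parity_even (u : {linear V -> V}) : linear_degree 0 u ->
  forall x, u (parity V x) = parity V (u x).
Proof.
move=> ue; elim/homog_ind=> [|x y hx hy|k x hx]; first by rewrite !linear0.
  by rewrite !linearD hx hy.
have := ue _ _ hx; rewrite addr0 => hux.
by rewrite (parityE hx) linearZ /= (parityE hux).
Qed.

End GradedInverse.

(** * Hodge decomposition compatible with the form *)

Section Hodge.
Variables (K : fieldType) (V : gradedSpace K) (w : V -> V -> K).
Hypothesis sw : odd_symplectic w.
Local Notation eps := (parity V).

Lemma sympDl x x' y : w (x + x') y = w x y + w x' y.
Proof. by rewrite -{1}[x]scale1r (symp_linl sw) mul1r. Qed.

Lemma sympDr x y y' : w x (y + y') = w x y + w x y'.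
Proof. by rewrite -{1}[y]scale1r (symp_linr sw) mul1r. Qed.

Lemma symp0l y : w 0 y = 0.
Proof. by apply: (@addIr _ (w 0 y)); rewrite -sympDl !add0r. Qed.

Lemma symp0r x : w x 0 = 0.
Proof. by apply: (@addIr _ (w x 0)); rewrite -sympDr !add0r. Qed.

Lemma sympZl a x y : w (a *: x) y = a * w x y.
Proof. by rewrite -[_ *: _]addr0 (symp_linl sw) symp0l addr0. Qed.

Lemma sympZr a x y : w x (a *: y) = a * w x y.
Proof. by rewrite -[_ *: _]addr0 (symp_linr sw) symp0r addr0. Qed.

Lemma sympNl x y : w (- x) y = - w x y.
Proof. by rewrite -scaleN1r sympZl mulN1r. Qed.

Lemma sympNr x y : w x (- y) = - w x y.
Proof. by rewrite -scaleN1r sympZr mulN1r. Qed.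

Lemma form_inj x x' : (forall y, w x y = w x' y) -> x = x'.
Proof.
move=> h; apply/eqP; rewrite -subr_eq0; apply/eqP.
by apply: (symp_nondeg sw).1 => y; rewrite sympDl sympNl h subrr.
Qed.

Lemma form_parity2 x y : w (eps x) (eps y) = - w x y.
Proof.
elim/homog_ind: x => [|x x' hx hx'|d x hx]; first by rewrite raddf0 !symp0l oppr0.
  by rewrite raddfD !sympDl hx hx' opprD.
elim/homog_ind: y => [|y y' hy hy'|e y hy]; first by rewrite raddf0 !symp0r oppr0.
  by rewrite raddfD !sympDr hy hy' opprD.
rewrite (parityE hx) (parityE hy) sympZl sympZr mulrA.
have [->|h] := eqVneq (w x y) 0; first by rewrite mulr0 oppr0.
rewrite -expfzDr ?oppr_eq0 ?oner_eq0 // (symp_degree sw hx hy h) expr1z.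
by rewrite mulN1r.
Qed.

(** Nondegeneracy in the strong sense provides, for homogeneous x, an element
    that represents the linear form w (eps x) (h _). *)
Lemma form_adjoint (h : {linear V -> V}) : linear_degree (-1) h ->
  exists2 k : {linear V -> V}, linear_degree (-1) k &
    forall x y, w (k x) y = w (eps x) (h y).
Proof.
move=> hd.
have loc d x : homog d x -> exists2 z, homog (d - 1) z &
    forall y, w z y = w (eps x) (h y).
  move=> hx; have hex := homog_parity hx.
  have lP : scalar (fun y => w (eps x) (h y)).
    by move=> a y y'; rewrite linearP (symp_linr sw).
  pose lam : {scalar V} := HB.pack (fun y => w (eps x) (h y))
    (GRing.isLinear.Build K V K *%R (fun y => w (eps x) (h y)) lP).
  have [z hz ez] := (symp_nondeg sw).2 (d - 1) lam.
  exists z => // y; elim/homog_ind: y => [|y y' hy hy'|e y hy].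
  - by rewrite raddf0 !symp0r.
  - by rewrite raddfD !sympDr hy hy'.
  have [ee|ne] := eqVneq e (1 - (d - 1)); first by apply: ez; rewrite -ee.
  have -> : w z y = 0.
    apply/eqP; apply: contra_neqT ne => /(symp_degree sw hz hy) E.
    by rewrite -[X in X - _]E addrAC subrr add0r.
  apply/esym/eqP; apply: contra_neqT ne => /(symp_degree sw hex (hd _ _ hy)) E.
  by rewrite -[X in X - _]E [X in X - _]addrCA addrK.
have /choice[k kP] x : exists z, forall y, w z y = w (eps x) (h y).
  elim/homog_ind: x => [|x x' [z hz] [z' hz']|d x /loc[z]].
  - by exists 0 => y; rewrite raddf0 !symp0l.
  - by exists (z + z') => y; rewrite raddfD !sympDl hz hz'.
  - by exists z.
have lk : linear k.
  move=> a x y; apply: form_inj => z.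
  by rewrite kP linearP !(symp_linl sw) !kP.
exists (mklinear lk) => // d x /= /loc[z hz ez].
by rewrite (_ : k x = z) //; apply: form_inj => y; rewrite kP ez.
Qed.

Variable d : {linear V -> V}.
Hypothesis dd : forall x, d (d x) = 0.
Hypothesis d1 : linear_degree 1 d.
Hypothesis dw : forall x y, w (d x) y = - w (eps x) (d y).
Hypothesis two : (2 : K) != 0.

(** These are the side conditions of homological perturbation theory; the sign
    in [contr_form] is opposite to the one satisfied by d. *)
Record contraction (h : {linear V -> V}) : Prop := Contraction {
  contr_degree : linear_degree (-1) h;
  contr_sq : forall x, h (h x) = 0;
  contr_dhd : forall x, d (h (d x)) = d x;
  contr_hdh : forall x, h (d (h x)) = h x;
  contr_form : forall x y, w (h x) y = w (eps x) (h y)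
}.

Let d_eps x : d (eps x) = - eps (d x).
Proof. by apply: parity_odd d1 _ x; rewrite expr1z. Qed.

Lemma sign_m1 : (-1 : K) ^ (-1 : int) = -1.
Proof. by rewrite exprN1 invrN1. Qed.

Lemma linear_degree_sum (e : int) (f g : V -> V) a :
  linear_degree e f -> linear_degree e g -> linear_degree e (fun x => a *: (f x + g x)).
Proof. by move=> hf hg k x hx; apply/homogZ/homogD; [apply: hf|apply: hg]. Qed.

(** Since d is self-adjoint up to sign, the adjoint of a generalized inverse is
    a generalized inverse too, and so is their mean. *)
Lemma symmetric_inverse : exists h : {linear V -> V},
  [/\ linear_degree (-1) h, forall x, d (h (d x)) = d x &
      forall x y, w (h x) y = w (eps x) (h y)].
Proof.
have [h hd hP] := graded_inverse d1; have [k kd kP] := form_adjoint hd.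
have h_eps x : h (eps x) = - eps (h x) by apply: parity_odd hd sign_m1 x.
have k_eps x : k (eps x) = - eps (k x) by apply: parity_odd kd sign_m1 x.
have dkd x : d (k (d x)) = d x.
  by apply: form_inj => y; rewrite dw -sympNl -k_eps kP parityK dw hP -dw.
have hk x y : w (h x) y = w (eps x) (k y).
  rewrite (symp_skew sw (k y)) kP h_eps sympNr opprK form_parity2.
  by rewrite (symp_skew sw y).
have hl : linear (fun x => 2^-1 *: (h x + k x)).
  move=> a x y; rewrite (linearP h) (linearP k) addrACA -[a *: h x + _]scalerDr [LHS]scalerDr.
  by rewrite !scalerA mulrC.
have half z : 2^-1 *: (z + z) = z :> V.
  by rewrite -mulr2n -scaler_nat scalerA mulVf // scale1r.
exists (mklinear hl); split=> [|x|x y] /=.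
- exact: linear_degree_sum.
- by rewrite linearZ linearD /= hP dkd half.
- by rewrite sympZl sympDl sympZr sympDr hk kP addrC.
Qed.

(** For a generalized inverse h, dh and hd are idempotents with
    (hd)(dh) = 0, but (dh)(hd) need not vanish.  Replacing them by
    dh - (dh)(hd)/2 and hd - (dh)(hd)/2 makes them orthogonal in a symmetric
    way, and these are dg and gd for g = h - (hhd + dhh)/2.  Then
    gdg is a contraction, because its square contains the factor dggd = 0. *)
Theorem hodge_contraction : exists h : {linear V -> V}, contraction h.
Proof.
have [h [hd hP hw]] := symmetric_inverse.
have h_eps x : h (eps x) = - eps (h x) by apply: parity_odd hd sign_m1 x.
pose g x := h x + (- 2^-1) *: (h (h (d x)) + d (h (h x))).
have gl : linear g.
  move=> a x y; rewrite /g !(linearP d, linearP h) [a *: h (h _) + _ + _]addrACA.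
  rewrite -[a *: _ + a *: _]scalerDr [_ *: (a *: _ + _)]scalerDr addrACA.
  by rewrite scalerA [- _ * a]mulrC -scalerA -scalerDr.
have gdeg : linear_degree (-1) g.
  move=> k x hx; apply: homogD; first exact: hd.
  apply: homogZ; apply: homogD.
    by have := hd _ _ (hd _ _ (d1 hx)); rewrite -[k + 1 - 1]addrA subrr addr0.
  by have := d1 (hd _ _ (hd _ _ hx)); rewrite addrAC addrK.
pose q x := d (h (h (d x))).
have gdE x : g (d x) = h (d x) - 2^-1 *: q x.
  by rewrite /g dd !linear0 add0r scaleNr.
have dgE x : d (g x) = d (h x) - 2^-1 *: q x.
  by rewrite /g linearD linearZ /= linearD /= dd addr0 scaleNr.
have dgd x : d (g (d x)) = d x.
  by rewrite gdE linearB linearZ /= dd scaler0 subr0 hP.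
have gg x : d (g (g (d x))) = 0.
  rewrite dgE /q dgd gdE linearB linearZ /= linearB linearZ /= hP -/(q x).
  rewrite -addrA -opprD -scalerDl -mulr2n -[2^-1 *+ 2]mulr_natr mulVf // scale1r.
  by rewrite subrr.
have gw x y : w (g x) y = w (eps x) (g y).
  rewrite /g sympDl sympDr sympZl sympZr sympDl sympDr hw; congr (_ + _ * _).
  have -> : w (h (h (d x))) y = w (eps x) (d (h (h y))).
    by rewrite hw -[eps (h (d x))]opprK -h_eps sympNl hw parityK dw opprK.
  have -> : w (d (h (h x))) y = w (eps x) (h (h (d y))).
    by rewrite dw -sympNl -h_eps hw parityK hw.
  by rewrite addrC.
have g_eps x : g (eps x) = - eps (g x).
  by apply: (parity_odd (u := mklinear gl)) gdeg sign_m1 x.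
have kl : linear (fun x => g (d (g x))).
  by move=> a x y; rewrite gl linearP gl.
exists (mklinear kl); split=> [k x hx|x|x|x|x y] /=.
- by have := gdeg _ _ (d1 (gdeg _ _ hx)); rewrite addrNK.
- by rewrite gg; apply: (linear0 (mklinear gl)).
- by rewrite !dgd.
- by rewrite !dgd.
- by rewrite gw -[eps (d (g x))]opprK -d_eps sympNl dw opprK parityK gw.
Qed.

End Hodge.

(** * Inverses *)

Section InverseLaws.
Variables (K : fieldType) (V : gradedSpace K).

Lemma resolvent_right (X : seq V -> V) : multilinear X ->
    (forall s, (size s < 2)%N -> X s = 0) ->
  mcomp (fun s => mid s - X s) (resolvent X) = @mid K V.
Proof.
move=> hX X0; apply: funext => -[|x s].
  by rewrite mcomp_nil X0 // subr0.
apply/eqP; rewrite -(subr_eq0 _ (mid _)) -[X in _ - X]opprK opprK.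
have -> : mcomp (fun s => mid s - X s) (resolvent X) (x :: s) =
   resolvent X (x :: s) - mcomp X (resolvent X) (x :: s).
  rewrite -[resolvent X _ in RHS]mcomp_midl.
  by rewrite /mcomp -sumrN -big_split.
by rewrite resolventE // addrK subrr.
Qed.

Lemma resolvent_degree (X : seq V -> V) : multilinear X ->
    (forall s, (size s < 2)%N -> X s = 0) ->
  has_degree 0 X -> has_degree 0 (resolvent X).
Proof.
move=> hX X0 dX.
have h n : has_degree 0 (resolvent_approx X n).
  elim: n => [|n IH]; apply/has_degreeP => D x s hD /=; first exact: homog0.
  apply: homogD; first exact: homog_image (@mid_degree K V) hD.
  exact: homog_image (mcomp_degree dX IH) hD.
apply/has_degreeP => D x s hD.
exact: homog_image (h (size (x :: s))) hD.
Qed.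

(** The resolvent of id - f is a right inverse g of f.  It has identity linear
    part as well, hence a right inverse, which must be f. *)
Lemma mcomp_inverse (f : seq V -> V) : multilinear f ->
    (forall s, (size s < 2)%N -> f s = mid s) ->
  exists g, [/\ multilinear g, has_degree 0 f -> has_degree 0 g,
     forall s, g s = mid s + mcomp (fun t => mid t - f t) g s,
     mcomp f g = @mid K V & mcomp g f = @mid K V].
Proof.
have main (f0 : seq V -> V) (ml0 : multilinear f0)
     (low0 : forall s, (size s < 2)%N -> f0 s = mid s) :
   [/\ multilinear (fun t => mid t - f0 t),
      forall s, (size s < 2)%N -> mid s - f0 s = 0 &
      mcomp f0 (resolvent (fun t => mid t - f0 t)) = @mid K V].
  have ml : multilinear (fun t => mid t - f0 t).
    have := multilinear_comb (-1) ml0 (@mid_multilinear K V).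
    by move=> h s1 s2 a x y; have := h s1 s2 a x y; rewrite !scaleN1r ![- _ + _]addrC.
  have low s : (size s < 2)%N -> mid s - f0 s = 0 by move=> /low0 ->; rewrite subrr.
  split=> //; rewrite -[RHS](resolvent_right ml low); congr (mcomp _ _).
  by apply: funext => s; rewrite subKr.
move=> mlf lowf; have [mlX lowX right_f] := main f mlf lowf.
set X := fun t => mid t - f t in mlX lowX right_f *.
set g := resolvent X in right_f.
have mlg : multilinear g by apply: resolvent_multilinear.
have lowg s : (size s < 2)%N -> g s = mid s.
  by move=> s2; rewrite /g resolventE // (mcomp_below _ lowX) // addr0.
have [_ _ right_g] := main g mlg lowg; set g' := resolvent _ in right_g.
have fg' : g' = f.
  have E : mcomp (mcomp f g) g' = mcomp f (@mid K V).
    by apply: funext => s; rewrite mcomp_assoc // right_g.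
  apply: funext => -[|x s]; first by rewrite lowf // /g' /resolvent /=.
  have := congr1 (fun u => u (x :: s)) E; rewrite right_f mcomp_midl => ->.
  by rewrite mcomp_midr.
exists g; split=> // [df|s|]; last by rewrite -[in LHS]fg'.
  apply: resolvent_degree => //; apply/has_degreeP => D x s hD.
  apply: homogD; first exact: homog_image (@mid_degree K V) hD.
  by apply: homogN; apply: homog_image df hD.
by rewrite {1}/g resolventE.
Qed.

End InverseLaws.

(** * Cyclicity *)

Section CyclicForm.
Variables (K : fieldType) (V : gradedSpace K) (w : V -> V -> K).
Hypothesis sw : odd_symplectic w.

(** Encoded as a family, the form can be composed with morphisms and
    coderivations; this turns cyclicity into [cyclic_mapP]. *)
Definition form_seq (s : seq V) : K^o := if s is [:: x; y] then w x y else 0.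

Lemma form_seq_multilinear : multilinear form_seq.
Proof.
move=> [|x1 [|x2 [|x3 s1]]] [|y1 [|y2 s2]] a x y /=;
  rewrite ?scaler0 ?addr0 //; [exact: (symp_linl sw) | exact: (symp_linr sw)].
Qed.

(** Cyclicity of m (for u the parity) or infinitesimal invariance of the form
    under m (for u the identity), with the rotation of the letters undone by
    the antisymmetry of the form. *)
Definition cyclic_map (u : V -> V) (m : seq V -> V) :=
  forall x s y, w (m (x :: s)) y + w (u x) (m (rcons s y)) = 0.

Lemma minsert_form_seq u m x s y :
  minsert u form_seq m (x :: rcons s y) =
  w (m (x :: s)) y + w (u x) (m (rcons s y)).
Proof.
rewrite /= csum_rcons csum_last ?addr0 => [|a z [|z' b] _] //.
congr (_ + _).
transitivity (minsert u (fun t => w (u x) (mid t) : K^o) m (rcons s y)).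
  apply: eq_minsert => z a b c _.
  by case: (map u a ++ m (z :: b) :: c) => [|v [|v0 t]] /=; rewrite ?(symp0r sw).
rewrite -(@minsert_morph K V V K^o (w (u x))); last exact: sympDr.
by case: s => [|z s]; rewrite [minsert _ _ _ _]minsert_midl.
Qed.

Lemma cyclic_mapP u m :
  cyclic_map u m <-> forall s, minsert u form_seq m s = 0.
Proof.
split=> [h [|x s]|h x s y]; last by rewrite -minsert_form_seq.
  by [].
case/lastP: s => [|s y]; first by rewrite /= !addr0.
by rewrite minsert_form_seq.
Qed.

Lemma mcomp_form_seq (f : seq V -> V) x s : f [::] = 0 ->
  mcomp form_seq f (x :: s) = csum (fun a b => w (f (x :: a)) (f b) : K^o) s.
Proof.
move=> f0; rewrite [LHS]big_blocks_cons; apply: eq_csum => a [|y b] _.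
  by rewrite big_seq1 f0 (symp0r sw).
transitivity (mcomp (fun t => w (f (x :: a)) (mid t) : K^o) f (y :: b)).
  apply: eq_bigr => P _ /=.
  by case: (map f P) => [|v [|v' t]] /=; rewrite ?(symp0r sw).
rewrite -(mcomp_midl f y b) /mcomp.
have h (I : Type) (r : seq I) (F : I -> V) :
    \sum_(i <- r) (w (f (x :: a)) (F i) : K^o) = w (f (x :: a)) (\sum_(i <- r) F i).
  by elim: r => [|i r IH]; rewrite ?big_nil ?(symp0r sw) // !big_cons IH (sympDr sw).
exact: h.
Qed.

(** The part of W o (id + X) which is linear in X vanishes because X leaves the
    form infinitesimally invariant, and what remains is even in X. *)
Lemma mcomp_form_pm (X : seq V -> V) : cyclic_map id X ->
    (forall s, (size s < 2)%N -> X s = 0) ->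
  mcomp form_seq (fun s => mid s + X s) = mcomp form_seq (fun s => mid s - X s).
Proof.
move=> hX X0; apply: funext => -[|x s]; first by rewrite !mcomp_nil.
rewrite !mcomp_form_seq /=; try by rewrite X0 // ?addr0 ?subr0.
pose cross a b : K^o := w (X (x :: a)) (mid b) + w (mid (x :: a)) (X b).
have cross0 : csum cross s = 0.
  case/lastP: s => [|s y].
    by rewrite /cross /= !X0 // (symp0l sw) (symp0r sw) !addr0.
  rewrite csumD csum_rcons csum_last ?(symp0r sw) ?addr0; last first.
    by move=> a z [|z' b] _; rewrite /= (symp0r sw).
  rewrite csumE [X in _ + (_ + X)](_ : _ = 0) ?addr0; first exact: hX.
  rewrite -[RHS](ncsum0 _ (rcons s y)); apply: eq_ncsum => z a b _.
  by rewrite /= (symp0l sw).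
pose even a b : K^o := w (mid (x :: a)) (mid b) + w (X (x :: a)) (X b).
transitivity (csum even s).
  rewrite -[RHS]addr0 -cross0 -csumD; apply: eq_csum => a b _.
  by rewrite !(sympDl sw) !(sympDr sw) /even /cross -!addrA; congr (_ + _);
     rewrite addrC -addrA addrCA; congr (_ + _); rewrite addrC.
rewrite -[LHS]subr0 -cross0 (csum_morph _ _ (@opprD K^o)) -csumD.
apply: eq_csum => a b _.
rewrite !(sympDl sw) !(sympDr sw) !(sympNl sw) !(sympNr sw) opprK /even /cross.
by rewrite opprD -!addrA; congr (_ + _); rewrite addrC -addrA addrCA; congr (_ + _); rewrite addrC.
Qed.

End CyclicForm.

(** * Form preserving automorphisms and transport of structure *)

Section Transport.
Variables (K : fieldType) (V : gradedSpace K) (w : V -> V -> K).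
Hypothesis sw : odd_symplectic w.
Hypothesis two : (2 : K) != 0.
Local Notation eps := (parity V).

Record cyclic_structure (m : seq V -> V) : Prop := CyclicStructure {
  cs_multilinear : multilinear m;
  cs_degree : has_degree 1 m;
  cs_nil : m [::] = 0;
  cs_ainf : forall s, minsert eps m m s = 0;
  cs_cyclic : cyclic_map w eps m
}.

(** Only morphisms whose linear part is the identity are considered. *)
Record cyclic_morphism (m m' f : seq V -> V) : Prop := CyclicMorphism {
  cm_multilinear : multilinear f;
  cm_degree : has_degree 0 f;
  cm_low : forall s, (size s < 2)%N -> f s = mid s;
  cm_morph : forall s, mcomp m' f s = minsert eps f m s;
  cm_form : mcomp (form_seq w) f = form_seq w
}.

(** The Cayley transform f = (id + X/2) o (id - X/2)^-1 does the job of the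
    exponential: W o (id + X/2) = W o (id - X/2) gives W o f = W. *)
Lemma cayley n (X : seq V -> V) : (1 < n)%N ->
    multilinear X -> has_degree 0 X -> (forall s, size s != n -> X s = 0) ->
    cyclic_map w id X ->
  exists f, [/\ multilinear f, has_degree 0 f,
    forall s, (size s <= n)%N -> f s = mid s + X s &
    mcomp (form_seq w) f = form_seq w].
Proof.
move=> n1 mlX dX Xn cX.
pose Y s := 2^-1 *: X s.
have mlY : multilinear Y.
  by move=> s1 s2 a x y; rewrite /Y mlX scalerDr !scalerA mulrC.
have dY : has_degree 0 Y by move=> t t0 ht; apply: homogZ; apply: dX.
have Yn s : size s != n -> Y s = 0 by move=> /Xn; rewrite /Y => ->; rewrite scaler0.
have Ylow s : (size s < n)%N -> Y s = 0.
  by move=> sn; apply: Yn; rewrite neq_ltn sn.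
have Ylow2 s : (size s < 2)%N -> Y s = 0.
  by move=> s2; apply: Ylow; apply: leq_trans s2 n1.
have cY : cyclic_map w id Y.
  by move=> x s y; rewrite /Y (sympZl sw) (sympZr sw) -mulrDr cX mulr0.
have mlsum a : multilinear (fun s => a *: Y s + mid s).
  exact: multilinear_comb mlY (@mid_multilinear K V).
have E1 : (fun s => mid s + Y s) = (fun s => 1 *: Y s + mid s).
  by apply: funext => s; rewrite scale1r addrC.
have E2 : (fun s => mid s - Y s) = (fun s => (-1) *: Y s + mid s).
  by apply: funext => s; rewrite scaleN1r addrC.
have mlp : multilinear (fun s => mid s + Y s) by rewrite E1.
have mlm : multilinear (fun s => mid s - Y s) by rewrite E2.
have [||g [mlg dg gE kg gk]] := @mcomp_inverse _ _ (fun s => mid s - Y s).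
- exact: mlm.
- by move=> s /Ylow2 ->; rewrite subr0.
have dgr : has_degree 0 g.
  apply: dg; apply/has_degreeP => D x s hD; apply: homogD.
    exact: homog_image (@mid_degree K V) hD.
  by apply: homogN; apply: homog_image dY hD.
have gE' s : g s = mid s + mcomp Y g s.
  by rewrite gE; congr (_ + _); apply: eq_bigr => P _; rewrite subKr.
exists (mcomp (fun s => mid s + Y s) g); split.
- exact: mcomp_multilinear.
- apply: mcomp_degree dgr; apply/has_degreeP => D x s hD; apply: homogD.
    exact: homog_image (@mid_degree K V) hD.
  exact: homog_image dY hD.
- have glow s : (size s < n)%N -> g s = mid s.
    by move=> sn; rewrite gE' (mcomp_below _ Ylow) // addr0.
  move=> s sn; have [->|s0] := eqVneq s [::].
    by rewrite mcomp_nil Ylow2 // Xn ?addr0 // eq_sym -lt0n ltnW.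
  have -> : mcomp (fun s => mid s + Y s) g s = g s + mcomp Y g s.
    by rewrite mcompDl; case: s s0 {sn} => // x s _; rewrite mcomp_midl.
  rewrite gE' -addrA -mulr2n; congr (_ + _).
  have -> : mcomp Y g s = Y s.
    move: sn; rewrite leq_eqVlt => /orP[/eqP sn|sn].
      by rewrite (mcomp_near_id mlY n1 glow sn) Ylow2 // add0r.
    by rewrite (mcomp_below _ Ylow) // Ylow.
  by rewrite /Y -scaler_nat scalerA divff // scale1r.
- apply: funext => s; rewrite -(mcomp_assoc _ _ _ (form_seq_multilinear sw)).
  rewrite (mcomp_form_pm sw cY) // (mcomp_assoc _ _ _ (form_seq_multilinear sw)).
  by rewrite kg mcomp_midr //; apply: form_seq_multilinear.
Qed.

Lemma cs_odd m : cyclic_structure m -> odd_map eps m.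
Proof.
move=> cs x s; rewrite (parity_map _ _ (cs_multilinear cs) (cs_degree cs)).
by rewrite expr1z scaleN1r.
Qed.

(** With g the inverse of f, the structure is (f m) g.  Its square and its effect
    on the form vanish after composition with f, by the intertwining property,
    and composition with f is injective. *)
Lemma transport m f : cyclic_structure m ->
    multilinear f -> has_degree 0 f -> (forall s, (size s < 2)%N -> f s = mid s) ->
    mcomp (form_seq w) f = form_seq w ->
  exists2 m', cyclic_structure m' & forall s, mcomp m' f s = minsert eps f m s.
Proof.
move=> cs mlf df lowf ff.
have [mlm dm m0 mm cm] := cs.
have [g [mlg dg _ fg gf]] := mcomp_inverse mlf lowf.
have {}dg := dg df.
have f0 : f [::] = 0 by rewrite lowf.
have fe := even_map mlf df f0.
pose m' := mcomp (minsert eps f m) g.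
have mlfm : multilinear (minsert eps f m) by apply: minsert_multilinear.
have mlm' : multilinear m' by apply: mcomp_multilinear.
have m'f s : mcomp m' f s = minsert eps f m s.
  by rewrite mcomp_assoc // gf mcomp_midr.
have cancel_f (W : lmodType K) (q : seq V -> W) : multilinear q ->
    (forall s, mcomp q f s = 0) -> forall s, q s = 0.
  move=> mlq qf s; rewrite -[q s]mcomp_midr // -fg -mcomp_assoc //.
  by apply: big1 => P _; apply: qf.
exists m' => //; split=> //.
- apply: mcomp_degree dg; rewrite -[1]add0r.
  by apply: minsert_degree => // k x; apply: homog_parity.
- by rewrite /m' mcomp_nil.
- apply: cancel_f; first exact: minsert_multilinear.
  move=> s; rewrite (minsert_mcomp (m := m) (e := eps)) //.
  have -> : mcomp m' f = minsert eps f m by apply: funext.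
  by apply: minsert_square => //; [apply: parityK | apply: cs_odd].
- apply/(cyclic_mapP sw); apply: cancel_f.
    by apply: minsert_multilinear => //; apply: form_seq_multilinear.
  move=> s; rewrite (minsert_mcomp (m := m) (e := eps)) //; last exact: form_seq_multilinear.
  by rewrite ff; apply: (proj1 (cyclic_mapP sw eps m) cm).
Qed.

(** In arity n, the equation m' f = f m involves only the arities 1 and n of f,
    that is the identity and X. *)
Lemma transport_step n m X : (1 < n)%N -> cyclic_structure m ->
    multilinear X -> has_degree 0 X -> (forall s, size s != n -> X s = 0) ->
    cyclic_map w id X ->
  exists m' f, [/\ cyclic_structure m', cyclic_morphism m m' f,
    forall s, (size s < n)%N -> f s = mid s,
    forall s, (size s < n)%N -> m' s = m s &
    forall s, size s = n ->
      m' s = m s - m [:: X s] + minsert eps X (unary (fun x => m [:: x])) s].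
Proof.
move=> n1 cs mlX dX Xn cX.
have [mlm dm m0 mm cm] := cs.
have [f [mlf df fE ff]] := cayley n1 mlX dX Xn cX.
have flow s : (size s < n)%N -> f s = mid s.
  by move=> sn; rewrite fE 1?ltnW // Xn ?addr0 // neq_ltn sn.
have flow2 s : (size s < 2)%N -> f s = mid s.
  by move=> s2; apply: flow; apply: leq_trans s2 n1.
have [m' cs' m'f] := transport cs mlf df flow2 ff.
have mlm' := cs_multilinear cs'.
have size_le (x : V) a b c (u : V) : (size (map eps a ++ u :: c) <= size (a ++ x :: b ++ c))%N.
  by rewrite !size_cat /= size_map size_cat leq_add2l ltnS leq_addl.
have below s : (size s < n)%N -> m' s = m s.
  case: s => [|x s] sn; first by rewrite (cs_nil cs') m0.
  rewrite -[LHS](mcomp_midr _ mlm').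
  transitivity (mcomp m' f (x :: s)).
    apply: (@eq_mcomp_size _ _ _ _ _ _ _ _ (size (x :: s))) => // t ts.
    by rewrite flow //; apply: leq_ltn_trans sn.
  rewrite m'f -[RHS](minsert_midl eps); apply: eq_minsert => y a b c e.
  by apply: flow; apply: leq_ltn_trans sn; rewrite -e.
exists m', f; split=> // s sn.
have := m'f s; rewrite (mcomp_near_id mlm' n1 flow sn).
rewrite below // fE ?sn // (_ : mid s = 0) ?add0r; last first.
  by case: s sn => [|x [|y s]] // sn; rewrite -sn in n1.
move=> h; apply: (addrI (m [:: X s])); rewrite h addrA [m [:: X s] + _]addrC subrK.
transitivity (minsert eps (fun t => mid t + X t) m s).
  by apply: eq_minsert => y a b c e; apply: fE; rewrite -sn -e.
rewrite minsertDl; case: s sn {h} => [|x s] sn; first by rewrite -sn in n1.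
rewrite minsert_midl; congr (_ + _).
apply: eq_minsert => y a [|z b] c e //=.
by rewrite !Xn // -sn -e !size_cat /= !size_map size_cat /= eqn_add2l neq_ltn
  !ltnS leq_addl.
Qed.

End Transport.

(** * The homotopy on cochains *)

Section Unary.
Variables (K : fieldType) (V W : lmodType K).

Lemma unary_multilinear (v : {linear V -> V}) : multilinear (unary v).
Proof.
move=> [|z [|z' s1]] [|y s2] a x x' /=; rewrite ?scaler0 ?addr0 //.
exact: linearP.
Qed.

Lemma minsert_unary_cons u (g : seq V -> W) v x s : multilinear g ->
  minsert u g (unary v) (x :: s) =
  g (v x :: s) + minsert u (fun t => g (u x :: t)) (unary v) s.
Proof.
move=> hg /=; congr (_ + _); rewrite csumE [X in _ + X](_ : _ = 0) ?addr0 //.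
rewrite -[RHS](ncsum0 _ s); apply: eq_ncsum => y a b _ /=.
exact: (multilinear0 [::]).
Qed.

Lemma minsert_unary_rcons u (g : seq V -> W) v s y : multilinear g ->
  minsert u g (unary v) (rcons s y) =
  minsert u (fun t => g (rcons t y)) (unary v) s + g (rcons (map u s) (v y)).
Proof.
elim: s g => [|x s IH] g hg.
  by rewrite [rcons _ _]/= minsert_unary_cons //= addr0 add0r.
rewrite rcons_cons !minsert_unary_cons //; last exact: multilinear_rcons.
by rewrite IH ?addrA //; apply: multilinear_cons.
Qed.

Lemma minsert_unary_size u (g : seq V -> W) v n s : multilinear g ->
    (forall t, size t != n -> g t = 0) -> size s != n ->
  minsert u g (unary v) s = 0.
Proof.
move=> hg gn sn; rewrite -(minsert0l _ u (unary v) s).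
apply: eq_minsert => y a [|z b] c e; last exact: multilinear0.
by rewrite gn // size_cat /= size_map; move: sn; rewrite -e size_cat.
Qed.

End Unary.

Lemma minsert_unary_l (K : fieldType) (V : lmodType K) u (l : {linear V -> V})
    (m : seq V -> V) x s :
  minsert u (unary l) m (x :: s) = l (m (x :: s)).
Proof.
transitivity (minsert u (fun t => l (mid t)) m (x :: s)).
  apply: eq_minsert => y a b c _.
  by case: (map u a ++ m (y :: b) :: c) => [|v [|v' t]] /=; rewrite ?linear0.
by rewrite -(minsert_morph _ _ _ _ (@linearD _ _ _ _ l)) minsert_midl.
Qed.

Lemma unary_degree (K : fieldType) (V : gradedSpace K) e (v : V -> V) :
  linear_degree e v -> has_degree e (unary v).
Proof.
move=> hv; apply/has_degreeP => D x [|y s] hD; last exact: homog0.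
have [[|[k u] [|t w]] [hw // [<-] <-]] := hD.
by rewrite /wdeg big_seq1; apply: hv; apply: (hw (k, u)); apply: mem_head.
Qed.

Lemma lin_scale (K : fieldType) (V W : lmodType K) (l : {linear V -> W}) a x :
  l (a *: x) = a *: l x.
Proof. by rewrite linearZ. Qed.

Section Homotopy.
Variables (K : fieldType) (V : gradedSpace K) (w : V -> V -> K).
Hypothesis sw : odd_symplectic w.
Hypothesis char0 : forall n, n.+1%:R != 0 :> K.
Local Notation eps := (parity V).

Variables d h : {linear V -> V}.
Hypothesis dd : forall x, d (d x) = 0.
Hypothesis d1 : linear_degree 1 d.
Hypothesis dw : forall x y, w (d x) y = - w (eps x) (d y).
Hypothesis hc : contraction w d h.

Let two : (2 : K) != 0. Proof. exact: (char0 1). Qed.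
Let hh := contr_sq hc.
Let dhd := contr_dhd hc.
Let hdh := contr_hdh hc.
Let hw := contr_form hc.
Let h1 := contr_degree hc.

Lemma acyclic_linear : linear (fun x => d (h x) + h (d x)).
Proof. by move=> a x y; rewrite !linearP /= addrACA -scalerDr. Qed.

Lemma harmonic_linear : linear (fun x => x - (d (h x) + h (d x))).
Proof.
move=> a x y; rewrite !(linearP h, linearP d).
by rewrite [X in _ - X]addrACA -scalerDr opprD addrACA -scalerBr.
Qed.

Definition acyclic_proj : {linear V -> V} := mklinear acyclic_linear.
Definition harmonic_proj : {linear V -> V} := mklinear harmonic_linear.
Local Notation ac := acyclic_proj.
Local Notation pr := harmonic_proj.

Lemma acyclic_projE x : ac x = d (h x) + h (d x). Proof. by []. Qed.
Lemma harmonic_projE x : pr x = x - ac x. Proof. by []. Qed.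

Lemma proj_add x : pr x + ac x = x. Proof. by rewrite harmonic_projE subrK. Qed.

Lemma d_ac x : d (ac x) = d x.
Proof. by rewrite acyclic_projE linearD dd add0r dhd. Qed.

Lemma h_ac x : h (ac x) = h x.
Proof. by rewrite acyclic_projE linearD hh addr0 hdh. Qed.

Lemma ac_d x : ac (d x) = d x.
Proof. by rewrite acyclic_projE dd linear0 addr0 dhd. Qed.

Lemma ac_h x : ac (h x) = h x.
Proof. by rewrite acyclic_projE hh linear0 add0r hdh. Qed.

Lemma ac_ac x : ac (ac x) = ac x.
Proof. by rewrite {1}acyclic_projE d_ac h_ac. Qed.

Lemma pr_ac x : pr (ac x) = 0. Proof. by rewrite harmonic_projE ac_ac subrr. Qed.
Lemma ac_pr x : ac (pr x) = 0.
Proof. by rewrite harmonic_projE linearB ac_ac subrr. Qed.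
Lemma pr_pr x : pr (pr x) = pr x.
Proof. by rewrite {1}harmonic_projE ac_pr subr0. Qed.
Lemma pr_h x : pr (h x) = 0. Proof. by rewrite harmonic_projE ac_h subrr. Qed.
Lemma pr_d x : pr (d x) = 0. Proof. by rewrite harmonic_projE ac_d subrr. Qed.
Lemma h_pr x : h (pr x) = 0. Proof. by rewrite harmonic_projE linearB h_ac subrr. Qed.
Lemma d_pr x : d (pr x) = 0. Proof. by rewrite harmonic_projE linearB d_ac subrr. Qed.

Lemma ac_degree : linear_degree 0 ac.
Proof.
move=> k x hx; rewrite addr0 acyclic_projE; apply: homogD.
  by have := d1 (h1 hx); rewrite subrK.
by have := h1 (d1 hx); rewrite addrK.
Qed.

Lemma pr_degree : linear_degree 0 pr.
Proof.
move=> k x hx; rewrite addr0 harmonic_projE; apply: homogD => //.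
by apply: homogN; have := ac_degree hx; rewrite addr0.
Qed.

Lemma d_eps x : d (eps x) = - eps (d x).
Proof. by apply: parity_odd d1 _ x; rewrite expr1z. Qed.

Lemma h_eps x : h (eps x) = - eps (h x).
Proof. by apply: parity_odd h1 _ x; apply: sign_m1. Qed.

Lemma ac_eps x : ac (eps x) = eps (ac x). Proof. exact: parity_even ac_degree x. Qed.
Lemma pr_eps x : pr (eps x) = eps (pr x). Proof. exact: parity_even pr_degree x. Qed.

Lemma form_h x y : w x (h y) = w (h (eps x)) y.
Proof. by rewrite hw parityK. Qed.

Lemma form_ac x y : w (ac x) y = w x (ac y).
Proof.
rewrite !acyclic_projE (sympDl sw) (sympDr sw) addrC; congr (_ + _).
  by rewrite hw -[eps (d x)]opprK -d_eps (sympNl sw) dw opprK parityK.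
by rewrite dw -(sympNl sw) -h_eps hw parityK.
Qed.

Lemma form_pr x y : w (pr x) y = w x (pr y).
Proof.
by rewrite !harmonic_projE (sympDl sw) (sympDr sw) (sympNl sw) (sympNr sw) form_ac.
Qed.

Lemma odd_unary_d : odd_map eps (unary d).
Proof. by move=> x [|y s] /=; rewrite ?d_eps // linear0 oppr0. Qed.

Lemma odd_unary_h : odd_map eps (unary h).
Proof. by move=> x [|y s] /=; rewrite ?h_eps // linear0 oppr0. Qed.

Definition harmonic (Z : seq V -> V) := forall s, Z s = pr (Z (map pr s)).

(** The graded commutator of d with Y, for Y of odd degree. *)
Definition bd (Y : seq V -> V) s := d (Y s) + minsert eps Y (unary d) s.

(** Up to sign, the action of h on all slots of the cyclic tensor w(_, Y(...)).
    The minus sign comes from [contr_form]; the graded commutator of h and Y,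
    which has a plus sign, would not be cyclic. *)
Definition homotopy (Y : seq V -> V) s := h (Y s) - minsert eps Y (unary h) s.

(** On a cyclic tensor with pure letters this is multiplication by the number of
    its slots, the output included, that are filled by acyclic letters. *)
Definition weight (Y : seq V -> V) s := ac (Y s) + minsert id Y (unary ac) s.

Section Cyclic.
Variable Y : seq V -> V.
Hypothesis mlY : multilinear Y.
Hypothesis dY : has_degree 1 Y.
Hypothesis cY : cyclic_map w eps Y.

Let oY : odd_map eps Y.
Proof. by move=> x s; rewrite (parity_map _ _ mlY dY) expr1z scaleN1r. Qed.

Lemma homotopy_multilinear : multilinear (homotopy Y).
Proof.
have ml := minsert_multilinear eps mlY (unary_multilinear h).
have := multilinear_comb (-1) ml (multilinear_linear h mlY).
by move=> H s1 s2 a x y; have := H s1 s2 a x y; rewrite !scaleN1r ![- _ + _]addrC.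
Qed.

Lemma bd_multilinear : multilinear (bd Y).
Proof.
have ml := minsert_multilinear eps mlY (unary_multilinear d).
have := multilinear_comb 1 (multilinear_linear d mlY) ml.
by move=> H s1 s2 a x y; have := H s1 s2 a x y; rewrite !scale1r.
Qed.

Lemma weight_multilinear : multilinear (weight Y).
Proof.
have ml := @minsert_multilinear _ _ _ [the {linear V -> V} of idfun] _ _ mlY
  (unary_multilinear ac).
have := multilinear_comb 1 (multilinear_linear ac mlY) ml.
by move=> H s1 s2 a x y; have := H s1 s2 a x y; rewrite !scale1r.
Qed.

Lemma homotopy_degree : has_degree 0 (homotopy Y).
Proof.
apply/has_degreeP => D x s hD; apply: homogD.
  by have := h1 (homog_image dY hD); rewrite addrK addr0.
apply: homogN; rewrite -[0](subrr 1).
exact: homog_image (minsert_degree (@homog_parity _ V) dY (unary_degree h1)) hD.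
Qed.

Lemma weight_degree : has_degree 1 (weight Y).
Proof.
apply/has_degreeP => D x s hD; apply: homogD.
  by have := ac_degree (homog_image dY hD); rewrite addr0.
rewrite -[1]addr0.
have hi := @minsert_degree _ _ _ _ _ id _ _ (fun _ _ hx => hx) dY.
exact: homog_image (hi _ _ (unary_degree ac_degree)) hD.
Qed.

Let zero_insert u v s x x' (y : V) : (forall t, w (Y (x :: t)) y + w x' (Y (rcons t y)) = 0) ->
  w (minsert u (fun t => Y (x :: t)) (unary v) s) y +
  w x' (minsert u (fun t => Y (rcons t y)) (unary v) s) = 0.
Proof.
move=> H.
rewrite (@minsert_morph _ _ _ K^o (fun z => w z y)); last first.
  by move=> a b; apply: (sympDl sw).
rewrite (@minsert_morph _ _ _ K^o (w x')); last first.
  by move=> a b; apply: (sympDr sw).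
transitivity (minsert u (fun t => w (Y (x :: t)) y + w x' (Y (rcons t y)) : K^o)
    (unary v) s).
  by rewrite [RHS]minsertDl.
by rewrite (@eq_minsert K V K^o u _ (fun=> 0) _ (unary v)) ?minsert0l //.
Qed.

Lemma homotopy_cyclic : cyclic_map w id (homotopy Y).
Proof.
move=> x s y; rewrite /homotopy minsert_unary_cons // minsert_unary_rcons //.
have M : w (minsert eps (fun t => Y (eps x :: t)) (unary h) s) y +
    w x (minsert eps (fun t => Y (rcons t y)) (unary h) s) = 0.
  by apply: zero_insert => t; rewrite -{2}[x](@parityK K V) cY.
rewrite !opprD !(sympDl sw) !(sympDr sw) !(sympNl sw) !(sympNr sw).
have -> : w (h (Y (x :: s))) y = w x (Y (rcons (map eps s) (h y))).
  rewrite hw -[eps (Y _)]opprK -oY /= (sympNl sw).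
  apply/eqP; rewrite eq_sym -addr_eq0 addrC; apply/eqP.
  by rewrite -{2}[x](@parityK K V) cY.
have -> : w x (h (Y (rcons s y))) = w (Y (h x :: s)) y.
  rewrite form_h h_eps (sympNl sw).
  by apply/eqP; rewrite eq_sym -addr_eq0 cY.
by move/eqP: M; rewrite addr_eq0 => /eqP ->; ring.
Qed.

Lemma weight_cyclic : cyclic_map w eps (weight Y).
Proof.
move=> x s y; rewrite /weight minsert_unary_cons // minsert_unary_rcons // map_id.
have M : w (minsert id (fun t => Y (x :: t)) (unary ac) s) y +
    w (eps x) (minsert id (fun t => Y (rcons t y)) (unary ac) s) = 0.
  by apply: zero_insert => t; apply: cY.
rewrite (sympDl sw (ac _)) (sympDr sw _ (ac _)) form_ac -(form_ac (eps x)) ac_eps.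
rewrite (sympDl sw) (sympDr sw).
have /eqP := cY x s (ac y); rewrite addr_eq0 => /eqP ->.
have /eqP := cY (ac x) s y; rewrite addr_eq0 => /eqP ->.
by move/eqP: M; rewrite addr_eq0 => /eqP ->; ring.
Qed.

(** As [d, h] is the acyclic projection, and h anticommutes with d in distinct
    slots, the commutator of d with the homotopy is the weight up to terms in
    which h is applied to [d, Y].  The latter is harmonic, hence killed
    by h. *)
Lemma homotopy_formula : harmonic (bd Y) ->
  forall x s, d (homotopy Y (x :: s)) - minsert eps (homotopy Y) (unary d) (x :: s)
    = weight Y (x :: s).
Proof.
move=> hZ x s; set t := x :: s.
have hD : {morph h : a b / a + b} by apply: linearD.
have dD : {morph d : a b / a + b} by apply: linearD.
have mld := unary_multilinear d.
have mlh := unary_multilinear h.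
have hY s' : h (minsert eps Y (unary d) s') = - h (d (Y s')).
  apply/eqP; rewrite -addr_eq0 addrC -linearD; apply/eqP.
  by have := hZ s'; rewrite /bd => ->; rewrite h_pr.
have bdh : minsert eps (bd Y) (unary h) t = 0.
  rewrite -[RHS](minsert0l V eps (unary h) t).
  apply: eq_minsert => y a b c _; rewrite hZ map_cat map_cons.
  have -> : pr (unary h (y :: b)) = 0 by case: b => [|z b]; rewrite ?pr_h ?linear0.
  by rewrite (multilinear0 _ _ bd_multilinear) linear0.
have E := minsert_anticomm (@parityK K V) t mlY odd_unary_h odd_unary_d.
have {E} : minsert eps (minsert eps Y (unary h)) (unary d) t
    + minsert eps (minsert eps Y (unary d)) (unary h) t = minsert id Y (unary ac) t.
  rewrite E; apply: eq_minsert => y a b c _; congr (Y (_ ++ _ :: _)).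
  rewrite !minsert_unary_l; case: b => [|z b] /=; first by rewrite addrC.
  by rewrite !linear0 addr0.
move=> E; rewrite /weight -E.
have -> : d (homotopy Y t) = d (h (Y t)) - d (minsert eps Y (unary h) t).
  by rewrite /homotopy linearB.
have -> : minsert eps (homotopy Y) (unary d) t =
    - h (d (Y t)) - minsert eps (minsert eps Y (unary h)) (unary d) t.
  rewrite -hY (minsert_morph _ _ _ _ hD).
  by rewrite (minsert_morph _ _ _ _ (@opprD V)) -minsertDl.
have -> : d (minsert eps Y (unary h) t) =
   - minsert eps (minsert eps Y (unary d)) (unary h) t.
  rewrite (minsert_morph _ _ _ _ dD); apply/eqP; rewrite -addr_eq0 -minsertDl.
  by apply/eqP.
move: (minsert eps (minsert eps Y (unary h)) (unary d) t)
  (minsert eps (minsert eps Y (unary d)) (unary h) t) => a b.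
by rewrite !opprD !opprK acyclic_projE addrACA [b + a]addrC.
Qed.

(** The weight is a commutator with d, whose square is zero. *)
Lemma bd_weight : harmonic (bd Y) -> forall x s, bd (weight Y) (x :: s) = 0.
Proof.
move=> hZ x s; set t := x :: s; pose X := homotopy Y.
have wE y u : weight Y (y :: u) = d (X (y :: u)) - minsert eps X (unary d) (y :: u).
  by rewrite homotopy_formula.
have -> : bd (weight Y) t = d (weight Y t) +
   minsert eps (fun u => d (X u) - minsert eps X (unary d) u) (unary d) t.
  congr (_ + _); apply: eq_minsert => y [|z a] b c _ /=; first exact: wE.
  by rewrite wE.
rewrite minsertDl -(minsert_morph _ _ _ _ (@linearD _ _ _ _ d)).
rewrite -(minsert_morph _ _ _ _ (@opprD V)).
rewrite (minsert_square (@parityK K V) t two homotopy_multilinear odd_unary_d).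
  by rewrite wE linearB dd sub0r oppr0 addr0 addNr.
by move=> y u; rewrite minsert_unary_l; case: u => [|z u] /=; rewrite ?dd ?linear0.
Qed.

End Cyclic.

(** The hypotheses on the operation of arity n under which the homotopy formula
    applies; they are stable under [deplete]. *)
Record arity_cochain n (Y : seq V -> V) : Prop := ArityCochain {
  cochain_multilinear : multilinear Y;
  cochain_degree : has_degree 1 Y;
  cochain_cyclic : cyclic_map w eps Y;
  cochain_arity : forall s, size s != n -> Y s = 0;
  cochain_bd : harmonic (bd Y)
}.

Definition deplete j (Y : seq V -> V) s := Y s - (j.+1%:R)^-1 *: weight Y s.

Lemma deplete_cochain n j Y : (0 < n)%N ->
  arity_cochain n Y -> arity_cochain n (deplete j Y).
Proof.
move=> n0 [ml dg cy ar hb].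
have mlw := weight_multilinear ml.
have arw s : size s != n -> weight Y s = 0.
  by move=> sn; rewrite /weight ar // linear0 add0r (minsert_unary_size _ _ ml ar).
have E s : deplete j Y s = (- (j.+1%:R)^-1) *: weight Y s + Y s.
  by rewrite /deplete scaleNr addrC.
split.
- have := multilinear_comb (- (j.+1%:R)^-1) mlw ml.
  by move=> H s1 s2 a x y; have := H s1 s2 a x y; rewrite -!E.
- apply/has_degreeP => D x s hD; apply: homogD; first exact: homog_image dg hD.
  by apply/homogN/homogZ; apply: homog_image (weight_degree dg) hD.
- move=> x s y; rewrite /deplete !(sympDl sw) !(sympDr sw) !(sympNl sw) !(sympNr sw).
  rewrite (sympZl sw) (sympZr sw) addrACA cy -opprD -mulrDr.
  by rewrite (weight_cyclic ml cy) mulr0 subr0.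
- by move=> s sn; rewrite /deplete ar // arw // scaler0 subr0.
move=> s; have bdE t : bd (deplete j Y) t = bd Y t - (j.+1%:R)^-1 *: bd (weight Y) t.
  rewrite /bd /deplete linearB linearZ /= scalerDr opprD addrACA; congr (_ + _).
  by rewrite minsertDl -(minsert_morph _ _ _ _ (@opprD V)) minsertZl.
have bw t : bd (weight Y) t = 0.
  case: t => [|x t]; last exact: bd_weight.
  by rewrite /bd arw ?linear0 ?addr0 // eq_sym -lt0n.
by rewrite !bdE !bw scaler0 !subr0; apply: hb.
Qed.

Fixpoint depleted j Y := if j is j'.+1 then deplete j' (depleted j' Y) else Y.

Lemma depleted_cochain n j Y : (0 < n)%N ->
  arity_cochain n Y -> arity_cochain n (depleted j Y).
Proof. by move=> n0 hY; elim: j => //= j IH; apply: deplete_cochain. Qed.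

(** Each step of [depleted] changes Y by a multiple of a weight, which the
    homotopy formula writes as a commutator with d. *)
Lemma depleted_homotopy n j Y : (1 < n)%N -> arity_cochain n Y ->
  exists X, [/\ multilinear X, has_degree 0 X, forall s, size s != n -> X s = 0,
    cyclic_map w id X &
    forall s, d (X s) - minsert eps X (unary d) s = Y s - depleted j Y s].
Proof.
move=> n1 hY; elim: j => [|j [X [ml dg ar cy hX]]].
  exists (fun=> 0); split=> // [s1 s2 a x y|t _ _|x s y|s].
  - by rewrite scaler0 addr0.
  - exact: homog0.
  - by rewrite (symp0l sw) (symp0r sw) addr0.
  by rewrite linear0 minsert0l !subrr.
have [mlj dgj cyj arj hbj] := depleted_cochain j (ltnW n1) hY.
set Yj := depleted j Y in mlj dgj cyj arj hbj hX *.
pose c : K := (j.+1%:R)^-1.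
have mlh := homotopy_multilinear mlj.
exists (fun s => c *: homotopy Yj s + X s); split.
- exact: multilinear_comb.
- move=> t t0 ht; apply: homogP; last exact: dg.
  exact: (homotopy_degree dgj).
- move=> s sn; rewrite ar // /homotopy arj // linear0 sub0r.
  by rewrite (minsert_unary_size _ _ mlj arj) // oppr0 scaler0 addr0.
- move=> x s y; rewrite !(symp_linl sw) !(symp_linr sw) addrACA -mulrDr.
  by rewrite (homotopy_cyclic mlj dgj cyj) cy mulr0 addr0.
move=> s; rewrite minsertDl minsertZl linearD linearZ /= opprD addrACA hX.
rewrite -scalerBr -/Yj /deplete -/c addrC opprB addrCA addrA.
case: s => [|x s]; last by rewrite homotopy_formula // addrC addrA.
have n0 : size ([::] : seq V) != n by rewrite eq_sym -lt0n ltnW.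
by rewrite /homotopy /weight !(arj _ n0) !(linear0, subr0, addr0, add0r, scaler0).
Qed.

Definition split_letter x := ac x = 0 \/ ac x = x.

Definition acyclic_count s := count (fun x => ac x != 0) s.

Lemma split_letter_spanning x :
  exists2 l : seq V, (forall y, y \in l -> split_letter y) & x = \sum_(y <- l) y.
Proof.
exists [:: pr x; ac x]; last by rewrite !big_cons big_nil addr0 proj_add.
by move=> y; rewrite !inE => /orP[] /eqP->; [left; apply: ac_pr | right; apply: ac_ac].
Qed.

Lemma weight_split (g : seq V -> V) s : multilinear g ->
    (forall x, x \in s -> split_letter x) ->
  minsert id g (unary ac) s = (acyclic_count s)%:R *: g s.
Proof.
move=> mlg hs; elim: s g mlg hs => [|x s IH] g mlg hs; first by rewrite scale0r.
rewrite minsert_unary_cons // (IH (fun t => g (x :: t))); first last.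
- by move=> y ys; apply: hs; rewrite inE ys orbT.
- exact: multilinear_cons.
rewrite (_ : acyclic_count (x :: s) = (ac x != 0%R) + acyclic_count s)%N //.
rewrite natrD scalerDl; congr (_ + _).
have [->|hx] := hs x (mem_head _ _).
  by rewrite eqxx scale0r (multilinear0 [::]).
case: eqP => [e|_]; last by rewrite hx scale1r.
by rewrite e scale0r (multilinear0 [::]).
Qed.

(** A slot filled by an acyclic letter has weight 1, so that
    [acyclic_count s] is the weight of the component with harmonic output, and
    its successor the weight of the one with acyclic output.  The weight j is
    killed by the factor of index j, and stays so. *)
Lemma depleted_split n j Y s : (0 < n)%N -> arity_cochain n Y ->
    (forall x, x \in s -> split_letter x) ->
  ((0 < acyclic_count s <= j)%N -> pr (depleted j Y s) = 0) /\
  ((acyclic_count s < j)%N -> ac (depleted j Y s) = 0).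
Proof.
move=> n0 hY hs; elim: j => [|j [IH1 IH2]].
  by split=> //; case: acyclic_count.
have [mlj _ _ _ _] := depleted_cochain j n0 hY.
have wE : weight (depleted j Y) s =
    ac (depleted j Y s) + (acyclic_count s)%:R *: depleted j Y s.
  by rewrite /weight weight_split.
set c := acyclic_count s in IH1 IH2 wE *; rewrite [depleted _ _ _]/= /deplete wE.
set v := depleted j Y s in IH1 IH2 *.
have nz : j.+1%:R != 0 :> K by apply: char0.
split=> [/andP[c0]|].
  rewrite (linearB pr) (lin_scale pr) (linearD pr) (lin_scale pr) pr_ac add0r scalerA leq_eqVlt => /orP[/eqP->|].
    by rewrite mulVf // scale1r subrr.
  by rewrite ltnS => cj; rewrite IH1 ?c0 // scaler0 subr0.
rewrite (linearB ac) (lin_scale ac) (linearD ac) (lin_scale ac).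
rewrite ac_ac -{2}[ac v]scale1r -scalerDl scalerA [1 + _]addrC natr1.
rewrite ltnS leq_eqVlt => /orP[/eqP->|/IH2 ->]; last by rewrite scaler0 subr0.
by rewrite mulVf // scale1r subrr.
Qed.

(** In arity n the weight is at most n + 1, so that only weight 0 survives. *)
Lemma depleted_harmonic n Y : (0 < n)%N -> arity_cochain n Y ->
  harmonic (depleted n.+1 Y).
Proof.
move=> n0 hY s; have hZ := depleted_cochain n.+1 n0 hY.
have [mlZ _ _ arZ _] := hZ; have [sn|sn] := eqVneq (size s) n; last first.
  by rewrite !arZ ?linear0 ?size_map.
apply: (multilinear_ext (n := n) (f := depleted n.+1 Y)
  (g := fun s => pr (depleted n.+1 Y (map pr s))) split_letter_spanning) => //.
  exact: multilinear_linear (multilinear_map _ mlZ).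
move=> {sn} s sn hs; have [h1' h2'] := depleted_split n.+1 n0 hY hs.
have cn : (acyclic_count s <= n)%N by rewrite -sn; apply: count_size.
have {}h2' := h2' cn; rewrite -[LHS]proj_add h2' addr0.
have [c0|c0] := posnP (acyclic_count s).
  rewrite map_id_in // => x xs.
  apply/eqP; rewrite harmonic_projE subr_eq addrC eq_sym -subr_eq0 addrK.
  move/eqP: c0; rewrite -leqn0 leqNgt -has_count => /hasPn /(_ x xs).
  by rewrite negbK.
rewrite h1' ?c0 1?ltnW //.
have /hasP[x xs acx] : has (fun x => ac x != 0) s by rewrite has_count.
have prx : pr x = 0.
  by case: (hs x xs) => [e|e]; [rewrite e eqxx in acx | rewrite -e pr_ac].
case/splitPr: xs => s1 s2.
by rewrite map_cat map_cons prx (multilinear0 _ _ mlZ) linear0.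
Qed.

Definition harmonic_below n (m : seq V -> V) :=
  forall s, (1 < size s < n)%N -> m s = pr (m (map pr s)).

Definition arity_part n (m : seq V -> V) s := if size s == n then m s else 0.

(** Insertions of harmonic families into each other stay harmonic, because the
    projection commutes with the parity. *)
Lemma harmonic_minsert (mu : seq V -> V) :
  harmonic mu -> harmonic (minsert eps mu mu).
Proof.
move=> hmu s; rewrite (minsert_morph _ _ _ _ (@linearD _ _ _ _ pr)).
rewrite !minsertE csum_map; apply: eq_csum => a t _.
rewrite ncsum_map; apply: eq_ncsum => x b c _.
have pr2 t' : map pr (map pr t') = map pr t'.
  by rewrite -map_comp; apply: eq_map => y; apply: pr_pr.
have -> : mu (map pr (x :: b)) = pr (mu (x :: b)).
  by rewrite hmu pr2 (hmu (x :: b)) pr_pr.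
rewrite hmu map_cat map_cons; congr (pr (mu (_ ++ _ :: _))).
by rewrite -!map_comp; apply: eq_map => y; apply: pr_eps.
Qed.

(** The A-infinity relation of arity n equates the commutator of d with the
    n-ary operation and, up to sign, the insertions into each other of the
    operations of intermediate arity, which are harmonic. *)
Lemma arity_part_cochain n m : (1 < n)%N -> cyclic_structure w m ->
    (forall x, m [:: x] = d x) -> harmonic_below n m ->
  arity_cochain n (arity_part n m).
Proof.
move=> n1 [mlm dm m0 mm cm] md hm; set Y := arity_part n m.
have mlY : multilinear Y.
  move=> s1 s2 a x y; rewrite /Y /arity_part !size_cat /=.
  by case: ifP => _; [apply: mlm | rewrite scaler0 addr0].
have Yn s : size s != n -> Y s = 0 by rewrite /Y /arity_part => /negPf ->.
have dY : has_degree 1 Y.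
  by move=> t t0 ht; rewrite /Y /arity_part; case: ifP => _; [apply: dm | apply: homog0].
split=> // [x s y|s].
  rewrite /Y /arity_part size_rcons /=; case: ifP => _; first exact: cm.
  by rewrite (symp0l sw) (symp0r sw) addr0.
have bd0 t : size t != n -> bd Y t = 0.
  by move=> tn; rewrite /bd Yn // linear0 (minsert_unary_size _ _ mlY Yn) ?addr0.
have [sn|sn] := eqVneq (size s) n; last by rewrite !bd0 ?linear0 ?size_map.
pose mu t := if (1 < size t < n)%N then m t else 0.
have hmu : harmonic mu.
  by move=> t; rewrite /mu size_map; case: ifP => [/hm|_]; rewrite ?linear0.
have bdE t : size t = n -> bd Y t = - minsert eps mu mu t.
  move=> tn; apply/eqP; rewrite -addr_eq0 -[X in _ == X](mm t); apply/eqP.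
  have -> : bd Y t = minsert eps (unary d) Y t + minsert eps Y (unary d) t.
    by congr (_ + _); case: t tn => [tn|x t _]; [rewrite -tn in n1 | rewrite minsert_unary_l].
  rewrite !minsertE -!csumD; apply: eq_csum => a t' e; rewrite -!ncsumD.
  apply: eq_ncsum => x b c e'.
  have {e'} e : (size a + (size b + size c).+1 = n)%N.
    by rewrite -tn -e -e' size_cat /= size_cat.
  case: b e => [|z b] e.
    have -> : Y [:: x] = 0 by rewrite Yn // neq_ltn n1.
    rewrite multilinear0 ?add0r; last exact: unary_multilinear.
    have sz u : size (map eps a ++ u :: c) = n by rewrite size_cat size_map.
    by rewrite /mu sz ltnn andbF addr0 /Y /arity_part sz eqxx /= md.
  rewrite [unary d _]/= (multilinear0 _ _ mlY) addr0.
  have [sb|sb] := eqVneq (size (x :: z :: b)) n.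
    have [a0 c0] : a = [::] /\ c = [::].
      by split; apply: size0nil; rewrite /= in e sb; lia.
    by rewrite a0 c0 /= /mu /= addr0 md /Y /arity_part sb eqxx.
  rewrite Yn // multilinear0 ?add0r; last exact: unary_multilinear.
  have sb2 : (1 < size (x :: z :: b) < n)%N by rewrite /= in e sb *; lia.
  have sz : (1 < size (map eps a ++ m (x :: z :: b) :: c) < n)%N.
    by rewrite size_cat size_map /=; rewrite /= in e sb *; lia.
  by rewrite /mu sb2 sz.
by rewrite !bdE ?size_map // linearN -harmonic_minsert.
Qed.

Lemma normal_step n m : (1 < n)%N -> cyclic_structure w m ->
    (forall x, m [:: x] = d x) -> harmonic_below n m ->
  exists m' f, [/\ cyclic_structure w m', cyclic_morphism w m m' f,
    forall s, (size s < n)%N -> f s = mid s,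
    forall s, (size s < n)%N -> m' s = m s &
    harmonic_below n.+1 m'].
Proof.
move=> n1 cs md hm; have hY := arity_part_cochain n1 cs md hm.
have [X [mlX dX Xn cX hX]] := depleted_homotopy n.+1 n1 hY.
have [m' [f [cs' cm' f_low m'_low m'n]]] := transport_step sw two n1 cs mlX dX Xn cX.
exists m', f; split=> // s /andP[s1]; rewrite ltnS leq_eqVlt => /orP[/eqP sn|sn].
  have m'E t : size t = n -> m' t = depleted n.+1 (arity_part n m) t.
    move=> tn; rewrite m'n // (_ : (fun x => m [:: x]) = d); last exact: funext.
    rewrite md -addrA [- _ + _]addrC -opprB hX.
    by rewrite {1}/arity_part tn eqxx subKr.
  by rewrite !m'E ?size_map //; apply: (depleted_harmonic (ltnW n1) hY).
by rewrite !m'_low ?size_map // hm ?s1.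
Qed.

(** * Composing infinitely many corrections *)

Lemma cyclic_morphism_id m : cyclic_structure w m -> cyclic_morphism w m m (@mid K V).
Proof.
move=> [mlm dm m0 mm cm]; split=> //.
- exact: mid_multilinear.
- exact: mid_degree.
- by case=> [|x s]; rewrite mcomp_midr // ?m0 // minsert_midl.
- by apply: funext => s; rewrite mcomp_midr //; apply: form_seq_multilinear.
Qed.

Lemma cyclic_morphism_comp m m' m'' f g : multilinear m'' ->
  cyclic_morphism w m m' f -> cyclic_morphism w m' m'' g ->
  cyclic_morphism w m m'' (mcomp g f).
Proof.
move=> ml'' [mlf df lf mf ff] [mlg dg lg mg fg].
have f0 : f [::] = 0 by rewrite lf.
split.
- exact: mcomp_multilinear.
- exact: mcomp_degree.
- case=> [|x [|y s]] // _; first by rewrite mcomp_nil lg.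
  by rewrite mcomp_cons /= addr0 mcomp_nil lg //= lf.
- move=> s; rewrite -mcomp_assoc // (_ : mcomp m'' g = minsert eps g m'); last exact: funext.
  rewrite (minsert_mcomp (m := m) (e := eps)) //.
  exact: even_map.
- apply: funext => s; rewrite -mcomp_assoc ?fg ?ff //.
  exact: form_seq_multilinear.
Qed.

Section Limit.
Variable m0 : seq V -> V.
Hypothesis cs0 : cyclic_structure w m0.
Hypothesis m0d : forall x, m0 [:: x] = d x.

Record stage N (mf : (seq V -> V) * (seq V -> V)) : Prop := Stage {
  st_cs : cyclic_structure w mf.1;
  st_cm : cyclic_morphism w m0 mf.1 mf.2;
  st_d : forall x, mf.1 [:: x] = d x;
  st_harm : harmonic_below N.+2 mf.1
}.

Lemma next_stage N (mf : {mf | stage N mf}) :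
  {mf' : {mf' | stage N.+1 mf'} | forall s, (size s < N.+2)%N ->
     (sval mf').1 s = (sval mf).1 s /\ (sval mf').2 s = (sval mf).2 s}.
Proof.
case: mf => -[m F] [/= cs cm md hm]; apply: cid.
have n2 : (1 < N.+2)%N by [].
have [m' [f [cs' cm' f_low m'_low hm']]] := normal_step n2 cs md hm.
have st : stage N.+1 (m', mcomp f F).
  split=> //= [|x]; last by rewrite m'_low.
  exact: cyclic_morphism_comp (cs_multilinear cs') cm cm'.
exists (exist _ _ st) => s sN /=; split; first exact: m'_low.
case: s sN => [|x s] sN; first by rewrite mcomp_nil f_low // (cm_low cm).
rewrite -[RHS]mcomp_midl; apply: (@eq_mcomp_size _ _ _ _ _ _ _ _ N.+1) => //.
Qed.

Lemma first_stage : stage 0 (m0, @mid K V).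
Proof.
split=> //=; first exact: cyclic_morphism_id.
by move=> s /andP[s1]; rewrite ltnS leqNgt s1.
Qed.

Fixpoint tower N : {mf | stage N mf} :=
  if N is N'.+1 then sval (next_stage (tower N')) else exist _ _ first_stage.

(** The operation of arity n is no longer modified after stage n. *)
Definition limit_op s := (sval (tower (size s))).1 s.
Definition limit_map s := (sval (tower (size s))).2 s.

Lemma tower_stable N s : (size s <= N)%N ->
  (sval (tower N)).1 s = limit_op s /\ (sval (tower N)).2 s = limit_map s.
Proof.
elim: N => [|N IH]; first by rewrite leqn0 /limit_op /limit_map => /eqP ->.
rewrite leq_eqVlt => /orP[/eqP <- //|sN].
have [e1 e2] := IH sN; rewrite -e1 -e2 /=.
by case: next_stage => /= mf'; apply; apply: leq_trans sN _.
Qed.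

(** Each identity involves, on a given sequence, only the operations up to its
    length, where the limit agrees with a single stage. *)
Lemma limit_normal_form :
  [/\ cyclic_structure w limit_op, cyclic_morphism w m0 limit_op limit_map,
      forall x, limit_op [:: x] = d x &
      forall s, (1 < size s)%N -> limit_op s = pr (limit_op (map pr s))].
Proof.
pose T N := sval (tower N).
have T1 N s : (size s <= N)%N -> limit_op s = (T N).1 s by move=> /tower_stable[].
have T2 N s : (size s <= N)%N -> limit_map s = (T N).2 s by move=> /tower_stable[].
have sT N : stage N (T N) := svalP (tower N).
have szc (x : V) u (v : V) a b c : (size (map u a ++ v :: c) <= size (a ++ x :: b ++ c))%N.
  by rewrite !size_cat /= size_map size_cat leq_add2l ltnS leq_addl.
have szb (x : V) a b c : (size (x :: b) <= size (a ++ x :: b ++ c))%N.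
  by rewrite size_cat /= size_cat; lia.
split.
- split.
  + move=> s1 s2 a x y; set N := size (s1 ++ x :: s2).
    have sz z : (size (s1 ++ z :: s2) <= N)%N by rewrite /N !size_cat.
    by rewrite !(T1 N) //; apply: (cs_multilinear (st_cs (sT N))).
  + move=> t t0 ht; rewrite /limit_op; apply: (cs_degree (st_cs (sT _))) => //.
  + by rewrite (T1 0) // (cs_nil (st_cs (sT 0))).
  + move=> s; rewrite -(cs_ainf (st_cs (sT (size s))) s).
    by apply: eq_minsert => x a b c e; rewrite !(T1 (size s)) // -e.
  + move=> x s y; rewrite !(T1 (size s).+1) ?size_rcons //.
    exact: (cs_cyclic (st_cs (sT _))).
- split.
  + move=> s1 s2 a x y; set N := size (s1 ++ x :: s2).
    have sz z : (size (s1 ++ z :: s2) <= N)%N by rewrite /N !size_cat.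
    by rewrite !(T2 N) //; apply: (cm_multilinear (st_cm (sT N))).
  + move=> t t0 ht; rewrite /limit_map; apply: (cm_degree (st_cm (sT _))) => //.
  + by move=> s s2; rewrite /limit_map (cm_low (st_cm (sT _))).
  + move=> s; set N := size s.
    transitivity (mcomp (T N).1 (T N).2 s).
      by apply: (@eq_mcomp_size _ _ _ _ _ _ _ _ N) => // t tN; [apply: T1|apply: T2].
    rewrite (cm_morph (st_cm (sT N))); apply: eq_minsert => x a b c e.
    by rewrite (T2 N) // /N -e.
  + apply: funext => s; set N := size s.
    rewrite -[in RHS](cm_form (st_cm (sT N))).
    by apply: (@eq_mcomp_size _ _ _ _ _ _ _ _ N) => // t tN; apply: T2.
- by move=> x; rewrite (T1 1) // (st_d (sT 1)).
- move=> s s1; rewrite !(T1 (size s)) ?size_map //.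
  by apply: (st_harm (sT (size s))); rewrite s1 ltnS leqnSn.
Qed.

End Limit.

Theorem harmonic_normal_form m : cyclic_structure w m ->
    (forall x, m [:: x] = d x) ->
  exists m' f, [/\ cyclic_structure w m', cyclic_morphism w m m' f,
    forall x, m' [:: x] = d x &
    forall s, (1 < size s)%N -> m' s = pr (m' (map pr s))].
Proof.
move=> cs0 m0d; exists (limit_op cs0 m0d), (limit_map cs0 m0d).
exact: limit_normal_form.
Qed.

End Homotopy.

(** * Comparison with the relations on homogeneous words *)

Section Link.
Variable K : fieldType.

Lemma sum_triangle (W : zmodType) n (F : nat -> nat -> W) :
  \sum_(0 <= j < n.+1) \sum_(1 <= l < (n - j).+1) F l j =
  \sum_(1 <= l < n.+1) \sum_(0 <= j < (n - l).+1) F l j.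
Proof.
transitivity (\sum_(0 <= j < n.+1) \sum_(1 <= l < n.+1 | (l + j <= n)%N) F l j).
  rewrite !big_mkord; apply: eq_bigr => j _.
  rewrite (big_nat_widen _ _ n.+1); last by rewrite ltnS leq_subr.
  by apply: eq_bigl => l; have := ltn_ord j; lia.
rewrite (exchange_big_dep_nat xpredT) //=; apply: eq_big_nat => l hl.
rewrite [RHS](big_nat_widen _ _ n.+1); last by rewrite ltnS leq_subr.
by apply: eq_bigl => j; lia.
Qed.

Lemma parity_prefix (V : gradedSpace K) (W : lmodType K) (phi : seq V -> W)
    (u : word V) t : multilinear phi -> homog_word u ->
  phi (map (parity V) (wvec u) ++ t) = wsign u *: phi (wvec u ++ t).
Proof.
move=> hphi hu; apply: (@parity_hseq _ _ _ (fun s => phi (s ++ t))).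
  by move=> s1 s2 a x y; rewrite -!catA hphi.
by exists u.
Qed.

Lemma homog_take (V : gradedSpace K) j (u : word V) :
  homog_word u -> homog_word (take j u).
Proof. by move=> hu t /mem_take; apply: hu. Qed.

(** On homogeneous words the parity of a prefix is the sign of the A-infinity
    relations. *)
Lemma minsert_words (V : gradedSpace K) (W : lmodType K) (phi : seq V -> W)
    (m : seq V -> V) (w : word V) : multilinear phi -> homog_word w ->
  minsert (parity V) phi m (wvec w) =
  \sum_(1 <= l < (size w).+1) \sum_(0 <= j < (size w - l).+1)
    wsign (take j w) *: phi (wvec (take j w) ++
      m (wvec (take l (drop j w))) :: wvec (drop (j + l) w)).
Proof.
move=> hphi hw; rewrite -sum_triangle minsertE csum_index size_map.
apply: eq_bigr => j _; rewrite ncsum_index size_drop size_map.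
apply: eq_bigr => l _.
rewrite -parity_prefix //; last exact: homog_take.
by rewrite /wvec /unzip2 !map_take !map_drop drop_drop [(j + l)%N]addnC.
Qed.

Lemma ainf_relationsP (V : gradedSpace K) (m : seq V -> V) : multilinear m ->
  ainf_relations m <-> forall s, minsert (parity V) m m s = 0.
Proof.
move=> hm.
have E (w : word V) : homog_word w ->
    \sum_(1 <= k < (size w).+1)
     \sum_(1 <= l < (size w).+1 | (k + l == (size w).+1)%N)
      \sum_(0 <= j < k)
        wsign (take j w) *:
          m (wvec (take j w) ++
             m (wvec (take l (drop j w))) :: wvec (drop (j + l) w)) =
    minsert (parity V) m m (wvec w).
  move=> hw; rewrite minsert_words //.
  rewrite (exchange_big_dep_nat xpredT) //=; apply: eq_big_nat => l hl.
  transitivity (\sum_(1 <= k < (size w).+1 | k == ((size w).+1 - l)%N)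
    \sum_(0 <= j < k) wsign (take j w) *: m (wvec (take j w) ++
             m (wvec (take l (drop j w))) :: wvec (drop (j + l) w))).
    by apply: eq_bigl => k; lia.
  rewrite big_nat1_eq ifT; last by lia.
  by rewrite subSn //; lia.
split=> [h s|h w _ hw]; last by rewrite E.
apply: (multilinear_ext (n := size s) (f := minsert (parity V) m m)
  (g := fun=> 0) (@homog_spanning _ V)) => //.
- exact: minsert_multilinear.
- by move=> s1 s2 a x y; rewrite scaler0 addr0.
move=> {s} [|x s] // _ hs; have [D [w [hw <- _]]] := hseq_exists hs.
case: w hw => // u w hw; rewrite -E //; exact: h.
Qed.

Section Structure.
Variables (V : gradedSpace K) (w : V -> V -> K).
Hypothesis sw : odd_symplectic w.

Lemma cyclic_relationsP (m : seq V -> V) : multilinear m ->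
  cyclic_relations w m <-> cyclic_map w (parity V) m.
Proof.
move=> hm; split=> [h x s y|h d1 d2 o1 o2 u h1 h2 hu]; last first.
  have /eqP := h o2 (wvec u) o1; rewrite (parityE h2) (sympZl sw).
  by rewrite addrC addr_eq0 => /eqP ->; apply: (symp_skew sw).
rewrite -(minsert_form_seq sw).
apply: (multilinear_ext (n := (size s).+2) (g := fun=> 0 : K^o)
  (f := minsert (parity V) (form_seq w) m) (@homog_spanning _ V)) => //=.
- by apply: minsert_multilinear => //; apply: form_seq_multilinear.
- by move=> s1 s2 a u v; rewrite scaler0 addr0.
- move=> [|z t] // _ hs; case/lastP: t hs => [|t b] hs; first by rewrite /= !addr0.
  rewrite [LHS](minsert_form_seq sw).
  have [d1 h1] : exists d, homog d z by apply: hs; rewrite mem_head.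
  have [d2 h2] : exists d, homog d b by apply: hs; rewrite inE mem_rcons mem_head orbT.
  have [|D [u [hu <- _]]] := @hseq_exists _ V t.
    by move=> v vt; apply: hs; rewrite inE mem_rcons inE vt !orbT.
  rewrite (symp_skew sw b) (h _ _ _ _ _ h2 h1 hu) (parityE h1) (sympZl sw).
  by rewrite addNr.
- by rewrite size_rcons.
Qed.

End Structure.

(** * Morphisms of tensor coalgebras *)

Lemma blocks_map (T T' : Type) (u : T -> T') s :
  blocks (map u s) = map (map (map u)) (blocks s).
Proof.
elim: s => //= x s ->; rewrite map_flatten -!map_comp; congr flatten.
by apply: eq_map => -[|b P].
Qed.

Lemma tensor_ext_sum (V V' W : lmodType K) (g : word V -> tensor V')
    (u : tensor V) (phi : seq V' -> W) :
  \sum_(t <- tensor_ext g u) t.1 *: phi (wvec t.2) =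
  \sum_(t <- u) t.1 *: \sum_(t' <- g t.2) t'.1 *: phi (wvec t'.2).
Proof.
rewrite /tensor_ext big_flatten big_map; apply: eq_bigr => t _.
by rewrite big_map scaler_sumr; apply: eq_bigr => t' _; rewrite scalerA.
Qed.

Lemma coalgebra_map_sum (V V' W : lmodType K) (f : seq V -> V')
    (phi : seq V' -> W) (w : word V) :
  \sum_(t <- coalgebra_map f w) t.1 *: phi (wvec t.2) = mcomp phi f (wvec w).
Proof.
rewrite /coalgebra_map big_map /mcomp [wvec w]/wvec /unzip2 blocks_map big_map.
apply: eq_bigr => P _; rewrite scale1r /wvec /unzip2 -!map_comp.
by congr phi; apply: eq_map.
Qed.

Lemma coderivation_sum (V : gradedSpace K) (W : lmodType K) (m : seq V -> V)
    (phi : seq V -> W) (w : word V) : multilinear phi -> homog_word w ->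
  \sum_(t <- coderivation m w) t.1 *: phi (wvec t.2) =
  minsert (parity V) phi m (wvec w).
Proof.
move=> hphi hw; rewrite minsert_words // /coderivation big_allpairs_dep.
rewrite /index_iota subn1; apply: eq_bigr => l _; rewrite subn0.
by apply: eq_bigr => j _; rewrite /wvec /unzip2 map_cat.
Qed.

Lemma wvec_blocks_homog (V V' : gradedSpace K) (f : seq V -> V') (w : word V) P :
    has_degree 0 f -> homog_word w -> P \in blocks w ->
  homog_word [seq (wdeg b, f (wvec b)) | b <- P].
Proof.
move=> df hw /mem_blocks[fP hP] t /mapP[b bP ->] /=.
rewrite -[wdeg b]addr0; apply: df.
  by have := allP hP b bP; case: b {bP}.
by move=> u ub; apply: hw; rewrite -fP; apply/flattenP; exists b.
Qed.

(** The equation between the coalgebra maps follows from its projection to B. *)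
Lemma ainf_morphismI (A B : ainfAlgebra K) (f : seq A -> B) :
    multilinear f -> has_degree 0 f -> f [::] = 0 ->
    (forall x s, mcomp (@ainf_op K B) f (x :: s) =
                 minsert (parity A) f (@ainf_op K A) (x :: s)) ->
  ainf_morphism f.
Proof.
move=> mlf df f0 hf; split=> // w hw W phi mlphi; rewrite !tensor_ext_sum.
transitivity (minsert (parity A) (mcomp phi f) (@ainf_op K A) (wvec w)).
  rewrite -coderivation_sum //; last exact: mcomp_multilinear.
  by apply: eq_bigr => t _; rewrite coalgebra_map_sum.
rewrite -(minsert_mcomp (e' := parity B) (m' := @ainf_op K B)) //; last first.
  by apply: even_map.
rewrite /coalgebra_map big_map /mcomp [wvec w]/wvec /unzip2 blocks_map big_map.
rewrite big_seq [RHS]big_seq; apply: eq_bigr => P hP.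
rewrite scale1r coderivation_sum //; last exact: wvec_blocks_homog hP.
congr minsert; rewrite /wvec /unzip2 -!map_comp.
exact: eq_map.
Qed.

Section Underlying.
Variable A : cyclicAinf K.

(** The value on the empty sequence is arbitrary in A, but is met in sums over
    cuts with a possibly empty part, where it has to be zero. *)
Definition ainf_op0 (s : seq A) : A := if nilp s then 0 else ainf_op s.

Lemma ainf_op0_structure : cyclic_structure (@cyc_form K A) ainf_op0.
Proof.
have ml : multilinear ainf_op0.
  by move=> [|z s1] s2 a x y; rewrite /ainf_op0 /=;
    [apply: (@ainf_multilinear _ A [::]) | apply: (@ainf_multilinear _ A (z :: s1))].
split=> //.
- by move=> [|t w] // _ hw; rewrite /ainf_op0 /=; apply: (@ainf_degree _ A (t :: w)).
- move=> s; transitivity (minsert (parity A) (@ainf_op K A) (@ainf_op K A) s).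
    by apply: eq_minsert => x [|y a] b c _.
  by apply: (proj1 (ainf_relationsP (@ainf_multilinear _ A))); apply: ainf_rel.
- have := proj1 (cyclic_relationsP (cyc_symp A) (@ainf_multilinear _ A)) (@cyc_rel _ A).
  by move=> h x s y; have := h x s y; rewrite /ainf_op0; case: s.
Qed.

End Underlying.

End Link.

(** * Direct summands *)

Section FixedSpace.
Variables (K : fieldType) (V : lmodType K) (p : {linear V -> V}).

Definition is_fixed : {pred V} := fun x => p x == x.

Fact is_fixed_submod : submod_closed is_fixed.
Proof.
split=> [|a x y /eqP hx /eqP hy]; first by rewrite unfold_in linear0.
by rewrite unfold_in linearP hx hy.
Qed.

HB.instance Definition _ := GRing.isSubmodClosed.Build K V is_fixed is_fixed_submod.

Record fixed := Fixed { fval : V; fvalP : fval \in is_fixed }.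

HB.instance Definition _ := [isSub for fval].
HB.instance Definition _ := [Choice of fixed by <:].
HB.instance Definition _ := [SubChoice_isSubLmodule of fixed by <:].

Lemma fval_fixed (x : fixed) : p (fval x) = fval x.
Proof. exact/eqP/(fvalP x). Qed.

Hypothesis pp : forall x, p (p x) = p x.

Definition fproj (x : V) : fixed.
Proof. by exists (p x); rewrite unfold_in pp. Defined.

End FixedSpace.

Section Summand.
Variables (K : fieldType) (V : gradedSpace K) (p : {linear V -> V}).
Hypothesis pp : forall x, p (p x) = p x.
Hypothesis pd : linear_degree 0 p.
Local Notation F := (fixed p).

Lemma fval_inj (x y : F) : fval x = fval y -> x = y.
Proof. exact: val_inj. Qed.

Lemma fval_comb a (x y : F) : fval (a *: x + y) = a *: fval x + fval y.
Proof. by []. Qed.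

Lemma fval0 : fval (0 : F) = 0. Proof. by []. Qed.

Lemma fval_sum I (r : seq I) (Q : pred I) (G : I -> F) :
  fval (\sum_(i <- r | Q i) G i) = \sum_(i <- r | Q i) fval (G i).
Proof. exact: (big_morph (@fval _ _ p)). Qed.

Lemma fprojE x : fval (fproj pp x) = p x. Proof. by []. Qed.

Definition fhomog (d : int) (x : F) := homog d (fval x).

Fact fhomog0 d : fhomog d 0. Proof. exact: homog0. Qed.

Fact fhomogP d a (x y : F) : fhomog d x -> fhomog d y -> fhomog d (a *: x + y).
Proof. exact: homogP. Qed.

Fact fhomog_span (x : F) : exists2 s : seq (int * F),
  (forall t, t \in s -> fhomog t.1 t.2) & x = \sum_(t <- s) t.2.
Proof.
have [s hs e] := homog_span (fval x).
exists [seq (t.1, fproj pp t.2) | t <- s].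
  by move=> t /mapP[u /hs hu ->]; have := pd hu; rewrite addr0.
apply: fval_inj; rewrite fval_sum big_map -[LHS](fval_fixed x) e raddf_sum.
by apply: eq_bigr.
Qed.

Fact fhomog_direct (ds : seq int) (y : int -> F) : uniq ds ->
  (forall d, fhomog d (y d)) -> \sum_(d <- ds) y d = 0 ->
  forall d, d \in ds -> y d = 0.
Proof.
move=> uds hy e d dds; apply: fval_inj; rewrite fval0.
apply: (homog_direct uds hy _ dds).
by rewrite -fval_sum e.
Qed.

Definition summand_space : gradedSpace K :=
  GradedSpace fhomog0 fhomogP fhomog_span fhomog_direct.

Variables (w : V -> V -> K) (m : seq V -> V).
Hypothesis sw : odd_symplectic w.
Hypothesis cs : cyclic_structure w m.
Hypothesis pw : forall x y, w (p x) y = w x (p y).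
Hypothesis pm : forall x s, m (map p (x :: s)) = p (m (x :: s)).

Local Notation S := summand_space.

Definition sval_word (u : word S) : word V := [seq (t.1, fval t.2) | t <- u].

Lemma homog_sval u : homog_word u -> homog_word (sval_word u).
Proof. by move=> hu t /mapP[v /hu hv ->]. Qed.

Lemma wvec_sval u : map (@fval _ _ p) (wvec u) = wvec (sval_word u).
Proof. by rewrite /wvec /unzip2 -!map_comp. Qed.

Lemma wdeg_sval u : wdeg (sval_word u) = wdeg u.
Proof. by rewrite /wdeg big_map. Qed.

Definition summand_op (s : seq S) : S := fproj pp (m (map (@fval _ _ p) s)).

Lemma summand_opE s : fval (summand_op s) = m (map (@fval _ _ p) s).
Proof.
case: s => [|x s]; first by rewrite fprojE (cs_nil cs) linear0.
rewrite fprojE -(pm (fval x)) /= fval_fixed -map_comp; congr (m (_ :: _)).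
by apply: eq_map => y; apply: fval_fixed.
Qed.

Lemma summand_multilinear : multilinear summand_op.
Proof.
move=> s1 s2 a x y; apply: fval_inj; rewrite fval_comb /summand_op !fprojE.
by rewrite !map_cat !map_cons fval_comb (cs_multilinear cs) linearP.
Qed.

Lemma summand_degree : has_degree 1 summand_op.
Proof.
move=> u u0 hu; rewrite /= /fhomog /summand_op fprojE wvec_sval -wdeg_sval.
rewrite -[_ + 1]addr0; apply: pd; apply: (cs_degree cs _ (homog_sval hu)).
by case: (u) u0.
Qed.

Lemma summand_rel : ainf_relations summand_op.
Proof.
move=> u u0 hu.
have := proj2 (ainf_relationsP (cs_multilinear cs)) (cs_ainf cs) (sval_word u).
rewrite size_map => /(_ u0 (homog_sval hu)) e.
apply: fval_inj; rewrite fval0 -[RHS]e fval_sum.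
apply: eq_bigr => k _; rewrite fval_sum; apply: eq_bigr => l _.
rewrite fval_sum; apply: eq_bigr => j _.
rewrite -[fval (_ *: _)]/(_ *: fval _) summand_opE map_cat map_cons summand_opE.
rewrite /sval_word -!map_take -!map_drop -!map_take -!/(sval_word _).
by rewrite !wvec_sval /wsign wdeg_sval.
Qed.

Definition summand_ainf : ainfAlgebra K :=
  AinfAlgebra summand_multilinear summand_degree summand_rel.

Definition summand_form (x y : summand_ainf) : K := w (fval x) (fval y).

(** A linear form on the summand extends to V by composition with p, and the
    element representing the extension can be projected, p being
    self-adjoint. *)
Lemma summand_symplectic : odd_symplectic summand_form.
Proof.
split=> [y a x x'|x a y y'|d e x y|x y|].
- exact: (symp_linl sw).
- exact: (symp_linr sw).
- exact: (symp_degree sw).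
- exact: (symp_skew sw).
split=> [x h|d lam].
  apply: fval_inj; apply: (symp_nondeg sw).1 => y.
  by rewrite -[fval x]fval_fixed pw -(fprojE y); apply: h.
have lP : scalar (fun y : V => lam (fproj pp y : S)).
  move=> a y y'; rewrite -linearP; congr (lam _).
  by apply: fval_inj; rewrite fval_comb !fprojE linearP.
pose lam' : {scalar V} := HB.pack (fun y : V => lam (fproj pp y : S))
  (GRing.isLinear.Build K V K *%R _ lP).
have [x hx ex] := (symp_nondeg sw).2 d lam'.
exists (fproj pp x : S) => [|y hy].
  by have := pd hx; rewrite addr0.
rewrite /summand_form fprojE pw fval_fixed ex //=; congr (lam _).
by apply: fval_inj; rewrite fprojE fval_fixed.
Qed.

Lemma summand_cyclic : cyclic_relations summand_form (@ainf_op K summand_ainf).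
Proof.
move=> d1 d2 o1 o2 u h1 h2 hu.
rewrite -[LHS]/(w (fval o1) (fval (summand_op (o2 :: wvec u)))).
rewrite -[X in _ * X]/(w (fval o2) (fval (summand_op (rcons (wvec u) o1)))).
rewrite !summand_opE.
rewrite map_cons map_rcons wvec_sval.
apply: (proj2 (cyclic_relationsP sw (cs_multilinear cs)) (cs_cyclic cs)) => //.
  exact: h1.
exact: homog_sval.
Qed.

(** The image of a self-adjoint idempotent p of degree 0 that commutes with all
    operations. *)
Definition summand : cyclicAinf K := CyclicAinf summand_symplectic summand_cyclic.

End Summand.

(** * The splitting *)

Section Splitting.
Variables (K : fieldType) (A : cyclicAinf K).
Local Notation w := (@cyc_form K A).
Let sw := cyc_symp A.
Variables (m : seq A -> A) (f : seq A -> A) (p q : {linear A -> A}).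
Hypothesis cs : cyclic_structure w m.
Hypothesis cm : cyclic_morphism w (@ainf_op0 K A) m f.
Hypothesis pp : forall x, p (p x) = p x.
Hypothesis qq : forall x, q (q x) = q x.
Hypothesis pd : linear_degree 0 p.
Hypothesis qd : linear_degree 0 q.
Hypothesis pw : forall x y, w (p x) y = w x (p y).
Hypothesis qw : forall x y, w (q x) y = w x (q y).
Hypothesis pm : forall x s, m (map p (x :: s)) = p (m (x :: s)).
Hypothesis qm : forall x s, m (map q (x :: s)) = q (m (x :: s)).
Hypothesis pq : forall x, p x + q x = x.

Let M := summand pp pd sw cs pw pm.
Let L := summand qq qd sw cs qw qm.

Definition split_map (s : seq A) : dsum M L := (fproj pp (f s) : M, fproj qq (f s) : L).

Let p_q x : p (q x) = 0.
Proof. by apply: (addrI (p (p x))); rewrite -linearD pq addr0 pp. Qed.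
Let q_p x : q (p x) = 0.
Proof. by apply: (addIr (q (q x))); rewrite -linearD pq add0r qq. Qed.

Lemma split_form x y : cyc_form (split_map x) (split_map y) = w (f x) (f y).
Proof.
rewrite -[LHS]/(w (p (f x)) (p (f y)) + w (q (f x)) (q (f y))).
by rewrite !pw qw pp qq -(sympDr sw) pq.
Qed.

Lemma split_map1 x : split_map [:: x] = (fproj pp x : M, fproj qq x : L).
Proof. by rewrite /split_map (cm_low cm). Qed.

Lemma split_ainf_morphism : ainf_morphism split_map.
Proof.
have [mlf df lf mf ff] := cm.
apply: ainf_morphismI.
- move=> s1 s2 a x y; rewrite /split_map mlf.
  by congr (_, _); apply: fval_inj; rewrite fval_comb !fprojE linearP.
- move=> t t0 ht; split; rewrite /= /fhomog fprojE -[_ + 0]addr0.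
    by apply: pd; apply: df.
  by apply: qd; apply: df.
- by rewrite /split_map lf //; congr (_, _); apply: fval_inj; rewrite fprojE linear0.
move=> x s.
have comp (r : {linear A -> A}) : (forall y t, m (map r (y :: t)) = r (m (y :: t))) ->
    r (minsert (parity A) f (@ainf_op K A) (x :: s)) =
    mcomp (fun t => m (map r t)) f (x :: s).
  move=> rm; have -> : minsert (parity A) f (@ainf_op K A) (x :: s) =
      mcomp m f (x :: s).
    by rewrite mf; apply: eq_minsert.
  rewrite -mcomp_linear; apply: eq_mcomp => -[|b P] // _ _.
  by rewrite rm.
have comp' (r : {linear A -> A}) : minsert (parity A) (fun t => r (f t)) (@ainf_op K A) (x :: s) =
    r (minsert (parity A) f (@ainf_op K A) (x :: s)).
  by rewrite (minsert_morph _ _ _ _ (@linearD _ _ _ _ r)).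
rewrite [LHS]surjective_pairing [RHS]surjective_pairing.
congr (_, _); apply: fval_inj.
  rewrite (@minsert_morph _ _ _ _ (fun u : dsum M L => fval u.1)) // comp' (comp p) //.
  rewrite /mcomp dsum_sum1 fval_sum; apply: eq_bigr => P _.
  rewrite -[LHS]/(fval (@summand_op K A p pp pd m (map fst (map split_map P)))).
  by rewrite (summand_opE cs pm) -!map_comp.
rewrite (@minsert_morph _ _ _ _ (fun u : dsum M L => fval u.2)) // comp' (comp q) //.
rewrite /mcomp dsum_sum2 fval_sum; apply: eq_bigr => P _.
rewrite -[LHS]/(fval (@summand_op K A q qq qd m (map snd (map split_map P)))).
by rewrite (summand_opE cs qm) -!map_comp.
Qed.

Lemma split_isomorphism : cyclic_ainf_isomorphism split_map.
Proof.
split; last first.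
  exists (fun u : dsum M L => fval u.1 + fval u.2) => [x|[u v]].
    by rewrite split_map1 /= pq.
  rewrite split_map1; have e1 := fval_fixed u; have e2 := fval_fixed v.
  congr (_, _); apply: fval_inj; rewrite fprojE linearD /=.
    by rewrite e1 -e2 p_q addr0.
  by rewrite e2 -e1 q_p add0r.
split; first exact: split_ainf_morphism.
  by move=> x y; rewrite split_form !(cm_low cm).
case=> [|x s] // s3.
have := congr1 (fun g => g (x :: s)) (cm_form cm).
rewrite (mcomp_form_seq sw) ?(cm_low cm) // csum_index.
rewrite (_ : form_seq w (x :: s) = 0); last first.
  by case: s s3 => [|y [|z s]].
rewrite big_nat_recr //= drop_size (cm_low cm (s := [::])) // (symp0r sw) addr0 => e.
rewrite -[RHS]e big_add1 /=; apply: eq_bigr => i _.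
exact: (split_form (x :: take i s)%SEQ (drop i s)).
Qed.

End Splitting.

Section Decomposition.
Variable K : fieldType.
Hypothesis char0 : forall n, n.+1%:R != 0 :> K.

(** The harmonic part is minimal because d vanishes on it.  The acyclic part is
    contractible because operations of higher arity kill acyclic letters and
    x = d h x for a cocycle x in it. *)
Theorem minimal_contractible_decomposition (A : cyclicAinf K) :
  exists M L : cyclicAinf K,
    [/\ minimal M, linear_contractible L &
        exists f : seq A -> dsum M L, cyclic_ainf_isomorphism f].
Proof.
pose w := @cyc_form K A; pose sw : odd_symplectic w := cyc_symp A.
pose m0 := @ainf_op0 K A.
have cs0 : cyclic_structure w m0 := ainf_op0_structure A.
have dl : linear (fun x => m0 [:: x]).
  by move=> a x y; apply: (cs_multilinear cs0 [::] [::]).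
pose d : {linear A -> A} := mklinear dl.
have dd x : d (d x) = 0.
  by have := cs_ainf cs0 [:: x]; rewrite /= !addr0.
have d1 : linear_degree 1 d.
  by move=> k x hx; apply: (homog_image (cs_degree cs0) (hseq1 hx)).
have dw x y : w (d x) y = - w (parity A x) (d y).
  by apply/eqP; rewrite -addr_eq0; apply/eqP; apply: (cs_cyclic cs0 x [::] y).
have two : (2 : K) != 0 := char0 1.
have [h hc] := hodge_contraction sw dd d1 dw two.
have [m [f [cs cm md mh]]] := harmonic_normal_form sw char0 dd d1 dw hc cs0 (fun x => erefl).
set pr := harmonic_proj d h in mh; set ac := acyclic_proj d h.
have prpr := pr_pr dd hc : forall x, pr (pr x) = pr x.
have acac := ac_ac dd hc : forall x, ac (ac x) = ac x.
have prac : forall x, pr (ac x) = 0 := pr_ac dd hc.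
have acpr : forall x, ac (pr x) = 0 := ac_pr dd hc.
have mpr x s : m (map pr (x :: s)) = pr (m (x :: s)).
  case: s => [|y s]; first by rewrite -[map pr _]/[:: pr x] !md (d_pr dd hc) (pr_d dd hc).
  rewrite [in RHS](mh (x :: y :: s)) // prpr [LHS]mh ?size_map //.
  by congr (pr (m _)); rewrite -!map_comp; apply: eq_map => z; apply: prpr.
have mac x s : m (map ac (x :: s)) = ac (m (x :: s)).
  case: s => [|y s]; first by rewrite -[map ac _]/[:: ac x] !md (d_ac dd hc) (ac_d dd hc).
  rewrite [LHS]mh ?size_map // (mh (x :: y :: s)) // acpr !map_cons prac.
  by rewrite (multilinear0 [::] _ (cs_multilinear cs)) linear0.
have pq x : pr x + ac x = x by apply: proj_add.
exists (summand prpr (pr_degree d1 hc) sw cs (form_pr sw d1 dw hc) mpr).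
exists (summand acac (ac_degree d1 hc) sw cs (form_ac sw d1 dw hc) mac).
split.
- move=> x; apply: fval_inj; apply: etrans (summand_opE cs mpr [:: x]) _.
  by rewrite [map _ _]/= md -(fval_fixed x) (d_pr dd hc).
- split=> [s s2|x e].
    apply: fval_inj; apply: etrans (summand_opE cs mac s) _.
    case: s s2 => // x s s2; rewrite mh ?size_map // !map_cons -(fval_fixed x) prac.
    by rewrite (multilinear0 [::] _ (cs_multilinear cs)) linear0.
  have dx : d (fval x) = 0.
    by rewrite -md -[RHS](congr1 (@fval _ _ _) e); apply/esym/(summand_opE cs mac [:: x]).
  exists (fproj acac (h (fval x))); apply: fval_inj.
  apply: etrans (esym (summand_opE cs mac [:: _])).
  rewrite -[map _ _]/[:: ac (h (fval x))] md (d_ac dd hc).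
  by rewrite -{1}(fval_fixed x) [LHS]acyclic_projE dx linear0 addr0.
- eexists; exact: (split_isomorphism cs cm prpr acac (pr_degree d1 hc)
    (ac_degree d1 hc) (form_pr sw d1 dw hc) (form_ac sw d1 dw hc) mpr mac pq).
Qed.

End Decomposition.

Local Open Scope complex_scope.

Theorem theorem5p15 (R : realType) (A : cyclicAinf R[i]) :
  exists M L : cyclicAinf R[i],
    [/\ minimal M, linear_contractible L &
        exists f : seq A -> dsum M L, cyclic_ainf_isomorphism f].
Proof.
apply: minimal_contractible_decomposition => n.
by rewrite Num.Theory.pnatr_eq0.
Qed.
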